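(* The equivalence of categories $(-)^{\downarrow}\colon\mathrm{br}\mathcal{M}on\to[\mathcal{BA}lg\mid\mathcal{M}on]$ between (non-degenerate) Boolean restriction monoids and (non-degenerate) matched pairs of algebras, given by $S\mapsto[E(S)\mid\mathrm{Tot}(S)]$ on objects and $\varphi\mapsto[\varphi|_{E(S)}\mid\varphi|_{\mathrm{Tot}(S)}]$ on morphisms, extends to an equivalence of categories $$(-)^{\downarrow}\colon\mathrm{gbr}\mathcal{M}on\longrightarrow[\mathrm{gr}\mathcal{BA}lg\mid\mathcal{M}on]$$ from the category of (non-degenerate) Grothendieck Boolean restriction monoids to the category of (non-degenerate) Grothendieck matched pairs of algebras, whose action on objects is $S_{\mathcal J}\mapsto[B_{\mathcal J}\mid M]$, where $B=E(S)$ and $M=\mathrm{Tot}(S)$.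
   Context: Boolean algebras have complement $b'$ and are non-degenerate if $0\neq1$. For $P\subseteq B$ write $P^-=P\setminus\{0\}$. A partition of $b\in B$ is a subset $P\subseteq B\setminus\{0\}$ with $\bigvee P=b$ and $c\wedge d=0$ for $c\ne d$ in $P$; ''partition'' alone means partition of $1$. A zero-dimensional topology on $B$ is a collection $\mathcal J$ of partitions containing every finite partition and such that: (i) if $P\in\mathcal J$ and $Q_b\in\mathcal J$ for each $b\in P$, then $\{b\wedge c:b\in P,c\in Q_b\}^-\in\mathcal J$; (ii) if $P\in\mathcal J$ and $\alpha\colon P\to I$ is surjective, then each $\bigvee\alpha^{-1}(i)$ exists and $\{\bigvee\alpha^{-1}(i):i\in I\}\in\mathcal J$. A Grothendieck Boolean algebra $B_{\mathcal J}$ is a Boolean algebra with such a topology; a homomorphism $f\colon B_{\mathcal J}\to C_{\mathcal K}$ is a Boolean homomorphism with $f(P)^-\in\mathcal K$ for all $P\in\mathcal J$. A $B$-set is a set $X$ with an operation $(b,x,y)\mapsto b(x,y)$, $B\times X\times X\to X$, satisfying $b(x,x)=x$, $b(b(x,y),z)=b(x,z)$, $b(x,b(y,z))=b(x,z)$, $1(x,y)=x$, $b'(x,y)=b(y,x)$, $(b\wedge c)(x,y)=b(c(x,y),y)$; write $x\equiv_by$ iff $b(x,y)=y$ (these equivalence relations determine the structure). A $B_{\mathcal J}$-set is a $B$-set $X$ with, for each infinite $P\in\mathcal J$, a function $P\colon X^P\to X$ with $P(\lambda b.x)=x$, $P(\lambda b.\,b(x_b,y_b))=P(\lambda b.\,x_b)$,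 $b(P(x),x_b)=x_b$ for $b\in P$; such functions are unique if they exist, and amount to the condition that for all $P\in\mathcal J$, $x\in X^P$ there is a unique $z\in X$ with $z\equiv_bx_b$ for all $b\in P$. A (non-degenerate) Grothendieck matched pair of algebras $[B_{\mathcal J}\mid M]$ is a non-degenerate Grothendieck Boolean algebra $B_{\mathcal J}$, a monoid $M$, a $B_{\mathcal J}$-set structure on $M$, and a left action $(m,b)\mapsto m^*b$ of $M$ on $B_{\mathcal J}$ by Grothendieck Boolean homomorphisms, such that: $m\equiv_bn\Rightarrow mp\equiv_bnp$; $n\equiv_bp\Rightarrow mn\equiv_{m^*b}mp$; $m\equiv_bn\Rightarrow b\wedge m^*c=b\wedge n^*c$. A homomorphism $[\varphi\mid f]$ is a Grothendieck Boolean homomorphism $\varphi$ and a monoid homomorphism $f$ with $m\equiv_bn\Rightarrow f(m)\equiv_{\varphi(b)}f(n)$ and $f(m)^*(\varphi(b))=\varphi(m^*b)$. These form $[\mathrm{gr}\mathcal{BA}lg\mid\mathcal{M}on]$. When $\mathcal J$ is the topology of all finite partitions one speaks of matched pairs $[B\mid M]$; these form $[\mathcal{BA}lg\mid\mathcal{M}on]$. A restriction monoid is a monoid $S$ with a unary operation $s\mapsto s^+$ with $s^+s=s$, $(s^+t)^+=s^+t^+$, $s^+t^+=t^+s^+$, $st^+=(st)^+s$. Put $E(S)=\{s^+:s\in S\}$, $\mathrm{Tot}(S)=\{s:s^+=1\}$, and order $S$ by $s\leqslant t$ iff $s^+t=s$. A Boolean restriction monoid is a restriction monoid $S$ such that $(E(S),\leqslant)$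 is a Boolean algebra; its least element $0$ is least in $S$; disjoint elements $s,t$ (i.e. $s^+t^+=0$) have a join $s\vee t$; $s0=0$ and $s(t\vee u)=st\vee su$ for $t,u$ disjoint. It is non-degenerate if $0\neq1$. Homomorphisms are monoid homomorphisms preserving $(-)^+$, $0$ and joins of disjoint pairs; these give $\mathrm{br}\mathcal{M}on$. Given a zero-dimensional topology $\mathcal J$ on $E(S)$, a subset $A\subseteq S$ is admissible if its elements are pairwise disjoint and $A^+=\{a^+:a\in A\}^-$ is contained in a partition in $\mathcal J$. $S_{\mathcal J}$ is a Grothendieck Boolean restriction monoid if every admissible $A$ has a join for $\leqslant$, and for $A$ admissible and $s\in S$ the set $sA=\{sa:a\in A\}$ is admissible with $\bigvee sA=s(\bigvee A)$. A homomorphism $S_{\mathcal J}\to T_{\mathcal K}$ is a homomorphism of Boolean restriction monoids which preserves admissible families and their joins; these give $\mathrm{gbr}\mathcal{M}on$. In $[E(S)\mid\mathrm{Tot}(S)]$ the structure is $m^*b=(mb)^+$, and $m\equiv_bn$ iff $bm=bn$. *)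

(* Defs.v *)
From HB Require Import structures.
From mathcomp Require Import all_boot all_order.
From mathcomp Require Import boolp classical_sets functions cardinality.

Set Implicit Arguments.
Unset Strict Implicit.
Unset Printing Implicit Defensive.

Import Order.Theory.

Local Open Scope classical_set_scope.

Record category : Type := Category {
  Ob :> Type;
  Hom : Ob -> Ob -> Type;
  idm : forall X : Ob, Hom X X;
  compm : forall X Y Z : Ob, Hom Y Z -> Hom X Y -> Hom X Z;
  comp1m : forall (X Y : Ob) (f : Hom X Y), compm (idm Y) f = f;
  compm1 : forall (X Y : Ob) (f : Hom X Y), compm f (idm X) = f;
  compmA : forall (W X Y Z : Ob) (h : Hom Y Z) (g : Hom X Y) (f : Hom W X),
    compm h (compm g f) = compm (compm h g) f }.

Arguments Hom {c} X Y.
Arguments idm {c} X.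
Arguments compm {c X Y Z} g f.

Record functor (C D : category) : Type := Functor {
  fob :> C -> D;
  fmap : forall X Y : C, Hom X Y -> Hom (fob X) (fob Y);
  fmap1 : forall X : C, fmap (idm X) = idm (fob X);
  fmapM : forall (X Y Z : C) (g : Hom Y Z) (f : Hom X Y),
    fmap (compm g f) = compm (fmap g) (fmap f) }.

Arguments fmap {C D} F {X Y} f : rename.

Definition functor_id (C : category) : functor C C :=
  @Functor C C (fun X => X) (fun X Y f => f) (fun X => erefl)
    (fun X Y Z g f => erefl).

Section FunctorComp.
Variables (C D E : category) (G : functor D E) (F : functor C D).

Let cmap (X Y : C) (f : Hom X Y) : Hom (G (F X)) (G (F Y)) := fmap G (fmap F f).

Lemma functor_comp1 (X : C) : cmap (idm X) = idm (G (F X)).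
Proof. by rewrite /cmap !fmap1. Qed.

Lemma functor_compM (X Y Z : C) (g : Hom Y Z) (f : Hom X Y) :
  cmap (compm g f) = compm (cmap g) (cmap f).
Proof. by rewrite /cmap !fmapM. Qed.

Definition functor_comp : functor C E := Functor functor_comp1 functor_compM.

End FunctorComp.

Definition is_iso (C : category) (X Y : C) (f : Hom X Y) : Prop :=
  exists g : Hom Y X, compm g f = idm X /\ compm f g = idm Y.

Definition nat_isomorphic (C D : category) (F G : functor C D) : Prop :=
  exists eta : forall X : C, Hom (F X) (G X),
    (forall (X Y : C) (f : Hom X Y),
       compm (fmap G f) (eta X) = compm (eta Y) (fmap F f)) /\
    (forall X : C, is_iso (eta X)).

Definition is_equivalence (C D : category) (F : functor C D) : Prop :=
  exists G : functor D C,
    nat_isomorphic (functor_comp G F) (functor_id C) /\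
    nat_isomorphic (functor_comp F G) (functor_id D).

Definition ba_disp : Order.disp_t := Order.Disp tt tt.

Notation boolAlg := (ctbDistrLatticeType ba_disp).

(* MathComp's [{tblmorphism B -> C}] only asks for preservation of \bot and
   \top, whence an explicit predicate. *)
Record is_boolean_hom (B C : boolAlg) (f : B -> C) : Prop := IsBooleanHom {
  bh_meet : {morph f : x y / (x `&` y)%O};
  bh_join : {morph f : x y / (x `|` y)%O};
  bh_bot : f \bot%O = \bot%O;
  bh_top : f \top%O = \top%O;
  bh_compl : {morph f : x / (~` x)%O} }.

Definition is_partition (B : boolAlg) (b : B) (P : set B) : Prop :=
  [/\ ~ P \bot%O, isLub P b &
      forall c d, P c -> P d -> c <> d -> (c `&` d)%O = \bot%O].

Definition fibre (B : boolAlg) (P : set B) (I : Type) (alpha : P -> I) (i : I)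
  : set B := [set val b | b in alpha @^-1` [set i]].

Record is_zd_topology (B : boolAlg) (J : set (set B)) : Prop := IsZdTopology {
  zd_partition : forall P, J P -> is_partition \top%O P;
  zd_finite : forall P, finite_set P -> is_partition \top%O P -> J P;
  zd_refine : forall (P : set B) (Q : B -> set B),
    J P -> (forall b, P b -> J (Q b)) ->
    J ((\bigcup_(b in P) [set (b `&` c)%O | c in Q b]) `\ \bot%O);
  zd_coarsen : forall (P : set B) (I : Type) (alpha : P -> I),
    J P -> (forall i, exists b, alpha b = i) ->
    (forall i, exists z, isLub (fibre alpha i) z) /\
    J [set z | exists i, isLub (fibre alpha i) z] }.

Definition finite_topology (B : boolAlg) : set (set B) :=
  [set P | finite_set P /\ is_partition \top%O P].

Arguments finite_topology B : clear implicits.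

Definition preserves_topology (B C : boolAlg) (J : set (set B))
    (K : set (set C)) (f : B -> C) : Prop :=
  forall P, J P -> K ((f @` P) `\ \bot%O).

Record is_Bset (B : boolAlg) (X : Type) (op : B -> X -> X -> X) : Prop :=
  IsBset {
  bs_diag : forall b x, op b x x = x;
  bs_left : forall b x y z, op b (op b x y) z = op b x z;
  bs_right : forall b x y z, op b x (op b y z) = op b x z;
  bs_top : forall x y, op \top%O x y = x;
  bs_compl : forall b x y, op (~` b)%O x y = op b y x;
  bs_meet : forall b c x y, op (b `&` c)%O x y = op b (op c x y) y }.

Definition bs_equiv (B : boolAlg) (X : Type) (op : B -> X -> X -> X) (b : B)
  (x y : X) : Prop := op b x y = y.

(* The operations [P : X^P -> X] are determined by the B-set structure, hence
   their existence is a property of the latter. *)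
Definition is_BJset (B : boolAlg) (J : set (set B)) (X : Type)
    (op : B -> X -> X -> X) : Prop :=
  is_Bset op /\
  forall P : set B, J P -> infinite_set P ->
    exists glue : (P -> X) -> X,
      [/\ forall x : X, glue (fun=> x) = x,
          forall x y : P -> X, glue (fun b => op (val b) (x b) (y b)) = glue x &
          forall (x : P -> X) (b : P), op (val b) (glue x) (x b) = x b].

Record is_matched_pair (B : boolAlg) (M : monoidType) (op : B -> M -> M -> M)
    (act : M -> B -> B) : Prop := IsMatchedPair {
  mpp_nondegenerate : \bot%O <> \top%O :> B;
  mpp_Bset : is_Bset op;
  mpp_act1 : forall b, act 1%g b = b;
  mpp_actM : forall m n b, act (m * n)%g b = act m (act n b);
  mpp_hom : forall m, is_boolean_hom (act m);
  mpp_right : forall b m n p, bs_equiv op b m n ->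
    bs_equiv op b (m * p)%g (n * p)%g;
  mpp_left : forall b m n p, bs_equiv op b n p ->
    bs_equiv op (act m b) (m * n)%g (m * p)%g;
  mpp_act : forall b c m n, bs_equiv op b m n ->
    (b `&` act m c)%O = (b `&` act n c)%O }.

Record matchedPair : Type := MatchedPair {
  mpB : boolAlg;
  mpM : monoidType;
  mp_op : mpB -> mpM -> mpM -> mpM;
  mp_act : mpM -> mpB -> mpB;
  mp_ax : is_matched_pair mp_op mp_act }.

Arguments mp_op {m} b x y : rename.
Arguments mp_act {m} x b : rename.

Record is_mp_hom (X Y : matchedPair) (phi : mpB X -> mpB Y)
    (f : mpM X -> mpM Y) : Prop := IsMpHom {
  mhp_bool : is_boolean_hom phi;
  mhp_mon : monoid_morphism f;
  mhp_equiv : forall b m n, bs_equiv mp_op b m n ->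
    bs_equiv mp_op (phi b) (f m) (f n);
  mhp_act : forall m b, mp_act (f m) (phi b) = phi (mp_act m b) }.

Record mp_hom (X Y : matchedPair) : Type := MpHom {
  mph_B : mpB X -> mpB Y;
  mph_M : mpM X -> mpM Y;
  mph_ax : is_mp_hom mph_B mph_M }.

Record is_gmatched_pair (X : matchedPair) (J : set (set (mpB X))) : Prop :=
  IsGMatchedPair {
  gmpp_top : is_zd_topology J;
  gmpp_BJset : is_BJset J (@mp_op X);
  gmpp_act : forall m : mpM X, preserves_topology J J (mp_act m) }.

Record gmatchedPair : Type := GMatchedPair {
  gmp_mp :> matchedPair;
  gmp_J : set (set (mpB gmp_mp));
  gmp_ax : is_gmatched_pair gmp_J }.

Record gmp_hom (X Y : gmatchedPair) : Type := GMpHom {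
  gmph :> mp_hom X Y;
  gmph_ax : preserves_topology (@gmp_J X) (@gmp_J Y) (mph_B gmph) }.

Record restrMonoid : Type := RestrMonoid {
  rm_monoid :> monoidType;
  rplus : rm_monoid -> rm_monoid;
  rplus_mul : forall s, (rplus s * s)%g = s;
  rplus_plus : forall s t, rplus (rplus s * t)%g = (rplus s * rplus t)%g;
  rplusC : forall s t, (rplus s * rplus t = rplus t * rplus s)%g;
  mul_rplus : forall s t, (s * rplus t = rplus (s * t) * s)%g }.

Arguments rplus {r} s : rename.

Section RestrictionOrder.
Variable S : restrMonoid.
Implicit Types (s t j : S) (A : set S).

Definition Idem : set S := range (@rplus S).

Definition Tot : set S := [set s : S | rplus s = 1%g].

Definition rle s t : Prop := (rplus s * t)%g = s.

Definition is_join A j : Prop :=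
  (forall a, A a -> rle a j) /\ (forall u, (forall a, A a -> rle a u) -> rle j u).

Lemma rplus_in s : rplus s \in Idem.
Proof. by rewrite in_setE; exists s. Qed.

Definition iplus s : Idem := exist (fun e => e \in Idem) (rplus s) (rplus_in s).

End RestrictionOrder.

Arguments Idem S : clear implicits.
Arguments Tot S : clear implicits.
Arguments iplus {S} s.

(* [br_class] together with [br_leE] says that (E(S), <=) is a Boolean algebra;
   all the operations in [br_class] are determined by the order. *)
Record brMonoidData : Type := BrMonoidData {
  br_rm :> restrMonoid;
  br_class : Order.CTBDistrLattice.axioms_ ba_disp (Idem br_rm) }.

Definition EBA (S : brMonoidData) : boolAlg := Order.CTBDistrLattice.Pack (br_class S).

Definition ev (S : brMonoidData) (e : EBA S) : S := val (e : Idem S).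

Definition rzero (S : brMonoidData) : S := ev (\bot%O : EBA S).

Definition rdisj (S : brMonoidData) (s t : S) : Prop :=
  (rplus s * rplus t)%g = rzero S.

Record is_brMonoid (S : brMonoidData) : Prop := IsBrMonoid {
  br_leE : forall e f : EBA S, (e <= f)%O <-> rle (ev e) (ev f);
  br_zero_le : forall s : S, rle (rzero S) s;
  br_join : forall s t : S, rdisj s t -> exists j, is_join [set s; t] j;
  br_mul0 : forall s : S, (s * rzero S)%g = rzero S;
  br_mulU : forall s t u j : S, rdisj t u -> is_join [set t; u] j ->
    is_join [set (s * t)%g; (s * u)%g] (s * j)%g;
  br_nondegenerate : rzero S <> 1%g }.

Record brMonoid : Type := BrMonoid {
  br_data :> brMonoidData;
  br_ax : is_brMonoid br_data }.

Record is_br_hom (S T : brMonoid) (f : S -> T) : Prop := IsBrHom {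
  brh_mon : monoid_morphism f;
  brh_plus : {morph f : s / rplus s};
  brh_zero : f (rzero S) = rzero T;
  brh_join : forall s t j : S, rdisj s t -> is_join [set s; t] j ->
    is_join [set f s; f t] (f j) }.

Record br_hom (S T : brMonoid) : Type := BrHom {
  brh_fun :> S -> T;
  brh_ax : is_br_hom brh_fun }.

Definition pairwise_rdisj (S : brMonoidData) (A : set S) : Prop :=
  forall a b, A a -> A b -> a <> b -> rdisj a b.

Definition admissible (S : brMonoid) (J : set (set (EBA S))) (A : set S) : Prop :=
  pairwise_rdisj A /\
  exists2 P, J P & ((iplus @` A : set (EBA S)) `\ \bot%O) `<=` P.

Record is_gbrMonoid (S : brMonoid) (J : set (set (EBA S))) : Prop :=
  IsGbrMonoid {
  gbr_top : is_zd_topology J;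
  gbr_join : forall A, admissible J A -> exists j, is_join A j;
  gbr_mul : forall (A : set S) (s : S), admissible J A ->
    admissible J [set (s * a)%g | a in A] /\
    forall j, is_join A j -> is_join [set (s * a)%g | a in A] (s * j)%g }.

Record gbrMonoid : Type := GbrMonoid {
  gbr_br :> brMonoid;
  gbr_J : set (set (EBA gbr_br));
  gbr_ax : is_gbrMonoid gbr_J }.

Record is_gbr_hom (S T : gbrMonoid) (f : S -> T) : Prop := IsGbrHom {
  gbrh_adm : forall A, admissible (@gbr_J S) A -> admissible (@gbr_J T) (f @` A);
  gbrh_join : forall A j, admissible (@gbr_J S) A -> is_join A j ->
    is_join (f @` A) (f j) }.

Record gbr_hom (S T : gbrMonoid) : Type := GbrHom {
  gbrh :> br_hom S T;
  gbrh_ax : is_gbr_hom gbrh }.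

Lemma is_boolean_hom_id (B : boolAlg) : is_boolean_hom (@idfun B).
Proof. by split. Qed.

Lemma is_boolean_hom_comp (B C D : boolAlg) (g : C -> D) (f : B -> C) :
  is_boolean_hom g -> is_boolean_hom f -> is_boolean_hom (g \o f).
Proof.
move=> [gI gU g0 g1 gC] [fI fU f0 f1 fC]; split=> /=.
- by move=> x y /=; rewrite fI gI.
- by move=> x y /=; rewrite fU gU.
- by rewrite f0 g0.
- by rewrite f1 g1.
- by move=> x /=; rewrite fC gC.
Qed.

Lemma preserves_topology_id (B : boolAlg) (J : set (set B)) :
  is_zd_topology J -> preserves_topology J J (@idfun B).
Proof.
move=> JJ P JP; rewrite image_id.
suff -> : P `\ \bot%O = P by [].
by rewrite not_setD1 //; case: (zd_partition JJ JP).
Qed.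

Lemma preserves_topology_comp (B C D : boolAlg) (J : set (set B))
    (K : set (set C)) (L : set (set D)) (g : C -> D) (f : B -> C) :
  g \bot%O = \bot%O -> preserves_topology J K f -> preserves_topology K L g ->
  preserves_topology J L (g \o f).
Proof.
move=> g0 fJK gKL P /fJK /gKL; congr (L _).
apply/seteqP; split=> d [] /=.
  by move=> [c [[b Pb <-] _] <-] gd0; split=> //; exists b.
move=> [b Pb <-] gfb0; split=> //; exists (f b) => //; split; first by exists b.
by move=> /= fb0; apply: gfb0; rewrite /= fb0.
Qed.

Lemma mp_hom_eq (X Y : matchedPair) (h k : mp_hom X Y) :
  mph_B h = mph_B k -> mph_M h = mph_M k -> h = k.
Proof.
case: h => hB hM hax; case: k => kB kM kax /= eB eM.
by subst kB kM; rewrite (Prop_irrelevance hax kax).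
Qed.

Lemma mp_id_ax (X : matchedPair) : is_mp_hom (@idfun (mpB X)) (@idfun (mpM X)).
Proof. by split=> //; exact: is_boolean_hom_id. Qed.

Definition mp_id (X : matchedPair) : mp_hom X X := MpHom (mp_id_ax X).

Lemma mp_comp_ax (X Y Z : matchedPair) (g : mp_hom Y Z) (f : mp_hom X Y) :
  is_mp_hom (mph_B g \o mph_B f) (mph_M g \o mph_M f).
Proof.
case: g f => gB gM [gb [gM1 gMM] ge ga] [fB fM [fb [fM1 fMM] fe fa]] /=.
split=> /=.
- exact: is_boolean_hom_comp.
- by split=> [|x y] /=; rewrite ?fM1 ?fMM ?gM1 ?gMM.
- by move=> b m n /fe /ge.
- by move=> m b; rewrite ga fa.
Qed.

Definition mp_comp (X Y Z : matchedPair) (g : mp_hom Y Z) (f : mp_hom X Y) :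
  mp_hom X Z := MpHom (mp_comp_ax g f).

Definition MPCat : category :=
  @Category matchedPair mp_hom mp_id mp_comp
    (fun X Y f => ltac:(by apply: mp_hom_eq))
    (fun X Y f => ltac:(by apply: mp_hom_eq))
    (fun W X Y Z h g f => ltac:(by apply: mp_hom_eq)).

Lemma gmp_hom_eq (X Y : gmatchedPair) (h k : gmp_hom X Y) :
  mph_B h = mph_B k -> mph_M h = mph_M k -> h = k.
Proof.
case: h => h hax; case: k => k kax /= eB eM.
have e := mp_hom_eq eB eM; subst k; by rewrite (Prop_irrelevance hax kax).
Qed.

Definition gmp_id (X : gmatchedPair) : gmp_hom X X :=
  @GMpHom X X (mp_id X) (preserves_topology_id (gmpp_top (gmp_ax X))).

Definition gmp_comp (X Y Z : gmatchedPair) (g : gmp_hom Y Z) (f : gmp_hom X Y) :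
    gmp_hom X Z :=
  @GMpHom X Z (mp_comp g f)
    (preserves_topology_comp (bh_bot (mhp_bool (mph_ax g)))
       (gmph_ax f) (gmph_ax g)).

Definition GMPCat : category :=
  @Category gmatchedPair gmp_hom gmp_id gmp_comp
    (fun X Y f => ltac:(by apply: gmp_hom_eq))
    (fun X Y f => ltac:(by apply: gmp_hom_eq))
    (fun W X Y Z h g f => ltac:(by apply: gmp_hom_eq)).

Lemma br_hom_eq (S T : brMonoid) (f g : br_hom S T) :
  brh_fun f = brh_fun g -> f = g.
Proof.
by case: f g => f fax [g gax] /= e; subst g; rewrite (Prop_irrelevance fax gax).
Qed.

Lemma br_id_ax (S : brMonoid) : is_br_hom (@idfun S).
Proof. by []. Qed.

Definition br_id (S : brMonoid) : br_hom S S := BrHom (br_id_ax S).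

Lemma br_hom_disj (S T : brMonoid) (f : br_hom S T) (s t : S) :
  rdisj s t -> rdisj (f s) (f t).
Proof.
have [[_ fM] fp f0 _] := brh_ax f.
by rewrite /rdisj -!fp -fM => ->.
Qed.

Lemma br_comp_ax (S T U : brMonoid) (g : br_hom T U) (f : br_hom S T) :
  is_br_hom (g \o f).
Proof.
have [[g1 gM] gp g0 gj] := brh_ax g.
have [[f1 fM] fp f0 fj] := brh_ax f.
split=> /=.
- by split=> [|x y] /=; rewrite ?f1 ?fM ?g1 ?gM.
- by move=> s /=; rewrite fp gp.
- by rewrite f0 g0.
- by move=> s t j dst stj; apply/gj/fj => //; exact: br_hom_disj.
Qed.

Definition br_comp (S T U : brMonoid) (g : br_hom T U) (f : br_hom S T) :
  br_hom S U := BrHom (br_comp_ax g f).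

Definition BRMonCat : category :=
  @Category brMonoid br_hom br_id br_comp
    (fun X Y f => ltac:(by apply: br_hom_eq))
    (fun X Y f => ltac:(by apply: br_hom_eq))
    (fun W X Y Z h g f => ltac:(by apply: br_hom_eq)).

Lemma gbr_hom_eq (S T : gbrMonoid) (f g : gbr_hom S T) :
  brh_fun f = brh_fun g -> f = g.
Proof.
case: f => f fax; case: g => g gax /= e.
by have e' := br_hom_eq e; subst g; rewrite (Prop_irrelevance fax gax).
Qed.

Lemma gbr_id_ax (S : gbrMonoid) : @is_gbr_hom S S (br_id S).
Proof. by split=> [A|A j]; rewrite image_id. Qed.

Definition gbr_id (S : gbrMonoid) : gbr_hom S S := GbrHom (gbr_id_ax S).

Lemma gbr_comp_ax (S T U : gbrMonoid) (g : gbr_hom T U) (f : gbr_hom S T) :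
  @is_gbr_hom S U (br_comp g f).
Proof.
have [ga gj] := gbrh_ax g; have [fa fj] := gbrh_ax f.
split=> /= [A|A j] Aadm.
  by rewrite -[X in admissible _ X]image_comp; exact/ga/fa.
by move=> Aj; rewrite -[X in is_join X]image_comp; apply: gj; [exact: fa|exact: fj].
Qed.

Definition gbr_comp (S T U : gbrMonoid) (g : gbr_hom T U) (f : gbr_hom S T) :
  gbr_hom S U := GbrHom (gbr_comp_ax g f).

Definition GBRMonCat : category :=
  @Category gbrMonoid gbr_hom gbr_id gbr_comp
    (fun X Y f => ltac:(by apply: gbr_hom_eq))
    (fun X Y f => ltac:(by apply: gbr_hom_eq))
    (fun W X Y Z h g f => ltac:(by apply: gbr_hom_eq)).

Section RestrictionTheory.
Variable S : restrMonoid.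
Implicit Types s t u : S.

Lemma rplus1 : rplus (1 : S)%g = 1%g.
Proof. by rewrite -[LHS]mulg1 rplus_mul. Qed.

Lemma rplusK s : rplus (rplus s) = rplus s.
Proof. by rewrite -[X in rplus X]mulg1 rplus_plus rplus1 mulg1. Qed.

Lemma rplus_idem s : (rplus s * rplus s)%g = rplus s.
Proof. by rewrite -rplus_plus rplus_mul. Qed.

Lemma rplus_mulr s t : rplus (s * rplus t)%g = rplus (s * t)%g.
Proof. by rewrite mul_rplus rplus_plus rplusC -rplus_plus mulgA rplus_mul. Qed.

Lemma rle_refl s : rle s s.
Proof. exact: rplus_mul. Qed.

Lemma rle_trans s t u : rle s t -> rle t u -> rle s u.
Proof.
rewrite /rle => st tu.
have -> : rplus s = (rplus s * rplus t)%g by rewrite -{1}st rplus_plus.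
by rewrite -mulgA tu.
Qed.

Lemma rle_anti s t : rle s t -> rle t s -> s = t.
Proof.
rewrite /rle => st ts.
have e1 : rplus s = (rplus s * rplus t)%g by rewrite -{1}st rplus_plus.
have e2 : rplus t = (rplus t * rplus s)%g by rewrite -{1}ts rplus_plus.
have e : rplus s = rplus t by rewrite e1 rplusC -e2.
by rewrite -st e rplus_mul.
Qed.

Lemma val_idem (e : Idem S) : rplus (val e) = val e.
Proof.
case: e => e eS /=; move: (eS); rewrite in_setE => -[s _ <-].
exact: rplusK.
Qed.

Lemma is_join_uniq (A : set S) j k : is_join A j -> is_join A k -> j = k.
Proof. by move=> [uj lj] [uk lk]; apply: rle_anti; [exact: lj|exact: lk]. Qed.

Lemma idem_rle (e : Idem S) s : rle (val e * s)%g s.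
Proof.
by rewrite /rle -val_idem rplus_plus -mulgA rplus_mul.
Qed.

End RestrictionTheory.

Section BooleanAlgebras.
Variable B : boolAlg.
Implicit Types (x y : B) (P Q : set B).

Lemma is_lub_uniq P x y : isLub P x -> isLub P y -> x = y.
Proof. by move=> [ue le] [uf lf]; apply/le_anti; rewrite le //= lf. Qed.

Lemma isLub_setD0 P x : isLub (P `\ \bot%O) x <-> isLub P x.
Proof.
have ubE : ubound (P `\ \bot%O) = ubound P.
  apply/seteqP; split=> u uub y; last by move=> [+ _]; exact: uub.
  by move=> Py; have [->|y0] := pselect (y = \bot%O); [exact: le0x|exact: uub].
by rewrite /isLub ubE.
Qed.

Lemma partition_subset P Q : is_partition \top%O Q -> P `<=` Q ->
  isLub P \top%O -> P = Q.
Proof.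
move=> [Q0 _ Qd] PQ [_ Plub]; apply/seteqP; split=> // q Qq.
apply: contrapT => nPq; apply: Q0; suff <- : q = \bot%O by [].
have /Plub : ubound P (~` q)%O.
  move=> p Pp; rewrite -disj_leC; apply/eqP; apply: Qd => //; first exact: PQ.
  by move=> pq; apply: nPq; rewrite -pq.
by rewrite le1x => /eqP q1; rewrite -[q]complK q1 compl1.
Qed.

Lemma compl_uniq x y : (x `&` y)%O = \bot%O -> (x `|` y)%O = \top%O ->
  y = (~` x)%O.
Proof.
move=> xy0 xy1; apply/le_anti/andP; split.
  by rewrite -disj_leC meetC xy0.
by rewrite -[X in (X <= _)%O]meetx1 -xy1 meetUr meetCx join0x leIr.
Qed.

End BooleanAlgebras.

Lemma is_boolean_hom_meet_compl (B C : boolAlg) (f : B -> C) :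
  {morph f : x y / (x `&` y)%O} -> f \bot%O = \bot%O ->
  (forall x, (f x `|` f (~` x)%O)%O = \top%O) -> is_boolean_hom f.
Proof.
move=> fI f0 fC'.
have fC : {morph f : x / (~` x)%O}.
  by move=> x; apply: compl_uniq => //; rewrite -fI meetxC f0.
have fU : {morph f : x y / (x `|` y)%O}.
  by move=> x y; rewrite -[LHS]complK -fC complU fI !fC complI !complK.
by split=> //; rewrite -compl0 fC f0 compl0.
Qed.

Section BooleanTheory.
Variable S : brMonoid.
Implicit Types (s t u j : S) (e f : EBA S) (A : set S).

Local Notation "# s" := (iplus s : EBA S) (at level 5).
Local Notation v := (@ev S).

Lemma EBA_val_inj e f : v e = v f -> e = f.
Proof. exact: (@val_inj S). Qed.

Lemma iplus_val e : # (v e) = e.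
Proof. by apply: EBA_val_inj; exact: val_idem. Qed.

Lemma iplusE s : v (# s) = rplus s. Proof. by []. Qed.

Lemma val_rplus e : rplus (v e) = v e.
Proof. exact: val_idem. Qed.

Lemma EBA_leP e f : (e <= f)%O <-> (v e * v f)%g = v e.
Proof.
split; first by move/(br_leE (br_ax S)); rewrite /rle val_idem.
by move=> h; apply/(br_leE (br_ax S)); rewrite /rle val_idem.
Qed.

Lemma val_meet e f : v (e `&` f)%O = (v e * v f)%g.
Proof.
pose g := # (v e * v f)%g.
have gE : v g = (v e * v f)%g.
  by rewrite iplusE -{1}val_rplus rplus_plus !val_rplus.
have fe : (v e * v f)%g = (v f * v e)%g.
  by rewrite -(val_rplus e) -(val_rplus f) rplusC.
have ee : (v e * v e)%g = v e by rewrite -{1}val_rplus rplus_mul.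
have ff : (v f * v f)%g = v f by rewrite -{1}val_rplus rplus_mul.
rewrite -gE; congr v; apply/le_anti/andP; split.
  have /EBA_leP h1 := leIl e f; have /EBA_leP h2 := leIr f e.
  by apply/EBA_leP; rewrite gE mulgA h1 h2.
rewrite lexI; apply/andP; split; apply/EBA_leP; rewrite gE.
  by rewrite fe -mulgA ee.
by rewrite -mulgA ff.
Qed.

Lemma val_top : v \top%O = 1%g.
Proof.
have /EBA_leP := lex1 (# 1%g); by rewrite iplusE rplus1 mul1g.
Qed.

Lemma rzeroE : rzero S = v \bot%O. Proof. by []. Qed.

Lemma rmul0 s : (rzero S * s)%g = rzero S.
Proof.
have := br_zero_le (br_ax S) s; by rewrite /rle /rzero val_rplus.
Qed.

Lemma rplus0 : rplus (rzero S) = rzero S.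
Proof. exact: val_idem. Qed.

Lemma iplus_eq0 s : # s = \bot%O -> s = rzero S.
Proof.
move/(congr1 v); rewrite iplusE => s0.
by rewrite -(rplus_mul s) s0 rmul0.
Qed.

Lemma rdisjE s t : rdisj s t <-> (# s `&` # t)%O = \bot%O.
Proof.
rewrite /rdisj; split=> [h|/(congr1 v)]; first by apply: EBA_val_inj; rewrite val_meet.
by rewrite val_meet.
Qed.

Lemma rleP s t : rle s t -> (# s <= # t)%O.
Proof. by move=> st; apply/EBA_leP; rewrite !iplusE -rplus_plus st. Qed.

Lemma rle_eq s t : rle s t -> rplus s = rplus t -> s = t.
Proof. by rewrite /rle => + e; rewrite e rplus_mul => ->. Qed.

Lemma val_mulP e s : rplus (v e * s)%g = (v e * rplus s)%g.
Proof. by rewrite -{1}(val_rplus e) rplus_plus val_rplus. Qed.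

Lemma is_join_iplus A j : is_join A j -> isLub (iplus @` A : set (EBA S)) (# j).
Proof.
move=> [ub lub]; split=> [_ [a Aa <-]|e eub]; first exact/rleP/ub.
have /lub : forall a, A a -> rle a (v e * j)%g.
  move=> a Aa; rewrite /rle mulgA.
  have /EBA_leP : (# a <= e)%O by apply: eub; exists a.
  by rewrite iplusE => ->; exact: ub.
move=> h; have := rleP h => /le_trans; apply.
apply/EBA_leP; rewrite iplusE val_mulP -iplusE -!val_meet.
by rewrite -meetA (meetC (# j)) meetA meetxx.
Qed.

Lemma iplus_mul e s : # (v e * s)%g = (e `&` # s)%O.
Proof. by apply: EBA_val_inj; rewrite val_meet !iplusE val_mulP. Qed.

Lemma rdisj_compl e s t : rdisj (v e * s)%g (v (~` e)%O * t)%g.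
Proof. by apply/rdisjE; rewrite !iplus_mul meetACA meetxC meet0x. Qed.

Lemma join_split e s : is_join [set (v e * s)%g; (v (~` e)%O * s)%g] s.
Proof.
have [j jJ] := br_join (br_ax S) (rdisj_compl e s s).
have js : rle j s by apply: jJ.2 => _ [->|->]; exact: idem_rle.
suff js1 : j = s by rewrite js1 in jJ.
apply: rle_eq => //; rewrite -!iplusE; congr v; apply/le_anti/andP.
split; first exact: rleP.
have [ub _] := is_join_iplus jJ.
rewrite -(meet1x (# s)) -(joinxC e) meetUl leUx.
rewrite -!iplus_mul; apply/andP; split; apply: ub.
  by exists (v e * s)%g => //; left.
by exists (v (~` e)%O * s)%g => //; right.
Qed.

Lemma glue_uniq e s t : (v e * s)%g = (v e * t)%g ->
  (v (~` e)%O * s)%g = (v (~` e)%O * t)%g -> s = t.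
Proof.
move=> h1 h2; have Js := join_split e s; have Jt := join_split e t.
by rewrite h1 h2 in Js; exact: is_join_uniq Js Jt.
Qed.

Lemma is_join_iplus2 s t j : is_join [set s; t] j -> # j = (# s `|` # t)%O.
Proof.
move=> /is_join_iplus [ub lub]; apply/le_anti/andP; split.
  by apply: lub => _ [a [->|->] <-]; rewrite ?leUl ?leUr.
rewrite leUx; apply/andP; split; apply: ub.
  by exists s => //; left.
by exists t => //; right.
Qed.

Lemma is_join_compl e : is_join [set v e; v (~` e)%O] 1%g.
Proof. by have := join_split e 1%g; rewrite !mulg1. Qed.

Lemma rdisj_val e f : rdisj (v e) (v f) <-> (e `&` f)%O = \bot%O.
Proof. by rewrite rdisjE !iplus_val. Qed.

Lemma iplus1 : # 1%g = \top%O.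
Proof. by apply: EBA_val_inj; rewrite iplusE rplus1 val_top. Qed.

Lemma is_join_lub_top (P : set (EBA S)) j : isLub P \top%O ->
  is_join (v @` P : set S) j -> j = 1%g.
Proof.
move=> Ptop jP; have := is_join_iplus jP.
have -> : iplus @` (v @` P) = P.
  rewrite image_comp; apply/seteqP; split=> [_ [e Pe <-]|e Pe] /=.
    by rewrite iplus_val.
  by exists e => //=; exact: iplus_val.
move=> /(is_lub_uniq Ptop) /(congr1 v); rewrite val_top iplusE => j1.
have : rle j 1%g.
  by apply: jP.2 => _ [e _ <-]; rewrite /rle val_rplus mulg1.
by rewrite /rle -j1 mul1g.
Qed.

Lemma glue_exists e s t : exists j, is_join [set (v e * s)%g; (v (~` e)%O * t)%g] j.
Proof.
exact/(br_join (br_ax S))/rdisj_compl.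
Qed.

Lemma val_idemM e : (v e * v e)%g = v e.
Proof. by rewrite -val_meet meetxx. Qed.

Lemma val_comm e f : (v e * v f)%g = (v f * v e)%g.
Proof. by rewrite -!val_meet meetC. Qed.

Lemma join_restrict A j a : is_join A j -> A a -> (rplus a * j)%g = a.
Proof. by move=> [+ _] => /(_ a) /[apply]. Qed.

Lemma val_mulCA e f s : (v e * (v f * s) = v f * (v e * s))%g.
Proof. by rewrite !mulgA val_comm. Qed.

(* [es \/ e't]; the default value is never reached, by [glue_exists]. *)
Definition glue e s t : S := xget s (is_join [set (v e * s)%g; (v (~` e)%O * t)%g]).

Lemma glueP e s t : is_join [set (v e * s)%g; (v (~` e)%O * t)%g] (glue e s t).
Proof.
by rewrite /glue; case: xgetP => [j -> //|]; have [j hj] := glue_exists e s t => /(_ j).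
Qed.

Lemma glue_tot e s t : rplus s = 1%g -> rplus t = 1%g -> rplus (glue e s t) = 1%g.
Proof.
move=> s1 t1; have [ub _] := is_join_iplus (glueP e s t).
rewrite -val_top -iplusE; congr v; apply/le_anti; rewrite lex1 /= -(joinxC e) leUx.
have h1 : # (v e * s)%g = e by apply: EBA_val_inj; rewrite iplusE val_mulP s1 mulg1.
have h2 : # (v (~` e)%O * t)%g = (~` e)%O.
  by apply: EBA_val_inj; rewrite iplusE val_mulP t1 mulg1.
apply/andP; split; apply: ub.
  by exists (v e * s)%g => //; left.
by exists (v (~` e)%O * t)%g => //; right.
Qed.

Lemma glue_l e s t : rplus s = 1%g -> (v e * glue e s t)%g = (v e * s)%g.
Proof.
move=> s1; have := join_restrict (glueP e s t) (or_introl erefl).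
by rewrite val_mulP s1 mulg1.
Qed.

Lemma glue_r e s t : rplus t = 1%g ->
  (v (~` e)%O * glue e s t)%g = (v (~` e)%O * t)%g.
Proof.
move=> t1; have := join_restrict (glueP e s t) (or_intror erefl).
by rewrite val_mulP t1 mulg1.
Qed.

End BooleanTheory.

Section TotalMonoid.
Variable S : restrMonoid.

Definition TotT : Type := Tot S.

HB.instance Definition _ := Choice.on TotT.

Definition tv (s : TotT) : S := val s.

Lemma tv_inj s t : tv s = tv t -> s = t.
Proof. exact: val_inj. Qed.

Lemma totP (s : TotT) : rplus (tv s) = 1%g.
Proof. by rewrite /tv; case: s => s /=; rewrite in_setE. Qed.

Lemma tot_one_subproof : (1%g : S) \in Tot S.
Proof. by rewrite in_setE; exact: rplus1. Qed.

Lemma tot_mul_subproof (s t : TotT) : (tv s * tv t)%g \in Tot S.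
Proof. by rewrite in_setE /Tot /= -rplus_mulr !totP mulg1 totP. Qed.

Definition tot_one : TotT := exist (fun s => s \in Tot S) 1%g tot_one_subproof.

Definition tot_mul (s t : TotT) : TotT :=
  exist (fun s => s \in Tot S) (tv s * tv t)%g (tot_mul_subproof s t).

Lemma tot_mulA : associative tot_mul.
Proof. by move=> s t u; apply: tv_inj; exact: mulgA. Qed.

Lemma tot_mul1 : left_id tot_one tot_mul.
Proof. by move=> s; apply: tv_inj; exact: mul1g. Qed.

Lemma tot_1mul : right_id tot_one tot_mul.
Proof. by move=> s; apply: tv_inj; exact: mulg1. Qed.

HB.instance Definition _ := isMonoid.Build TotT tot_mulA tot_mul1 tot_1mul.

End TotalMonoid.

Section DownObject.
Variable S : brMonoid.
Implicit Types (b c : EBA S) (m n p : TotT S).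

Local Notation "# s" := (iplus s : EBA S) (at level 5).
Local Notation v := (@ev S).

Lemma down_op_subproof b m n : glue b (tv m) (tv n) \in Tot S.
Proof. by rewrite in_setE; apply: glue_tot; exact: totP. Qed.

(* [b(m, n) = bm \/ b'n] is the B-set structure on Tot(S) for which
   [m ==_b n] iff [bm = bn], see [down_equivE]. *)
Definition down_op b m n : TotT S :=
  exist (fun s => s \in Tot S) (glue b (tv m) (tv n)) (down_op_subproof b m n).

Definition down_act m b : EBA S := # (tv m * v b)%g.

Lemma down_opl b m n : (v b * tv (down_op b m n))%g = (v b * tv m)%g.
Proof. by apply: glue_l; exact: totP. Qed.

Lemma down_opr b m n :
  (v (~` b)%O * tv (down_op b m n))%g = (v (~` b)%O * tv n)%g.
Proof. by apply: glue_r; exact: totP. Qed.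

Lemma down_op_uniq b m n p : (v b * tv p)%g = (v b * tv m)%g ->
  (v (~` b)%O * tv p)%g = (v (~` b)%O * tv n)%g -> p = down_op b m n.
Proof.
move=> h1 h2; apply: tv_inj; apply: (@glue_uniq _ b).
  by rewrite h1 down_opl.
by rewrite h2 down_opr.
Qed.

Lemma down_equivE b m n :
  bs_equiv down_op b m n <-> (v b * tv m)%g = (v b * tv n)%g.
Proof.
rewrite /bs_equiv; split=> [<-|h]; first by rewrite down_opl.
by apply/esym/down_op_uniq.
Qed.

Lemma down_Bset : is_Bset down_op.
Proof.
split=> [b m|b m n p|b m n p|m n|b m n|b c m n].
- exact/esym/down_op_uniq.
- by apply: down_op_uniq; rewrite ?down_opl ?down_opr.
- by apply: down_op_uniq; rewrite ?down_opl ?down_opr.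
- apply/esym/down_op_uniq => //.
  by rewrite compl1 -rzeroE !rmul0.
- apply/esym/down_op_uniq; first by rewrite down_opr.
  by rewrite complK down_opl.
- apply/esym/down_op_uniq.
    rewrite meetC val_meet -!mulgA down_opl [LHS]val_mulCA down_opl.
    by rewrite [LHS]val_mulCA.
  apply: (@glue_uniq _ b); rewrite complI !mulgA -val_meet.
    rewrite meetUr meetxC join0x meetC val_meet -!mulgA down_opl.
    by rewrite [LHS]val_mulCA down_opr [LHS]val_mulCA.
  by rewrite joinKI down_opr.
Qed.

Lemma mul_val_rplus s b : (s * v b)%g = (v (# (s * v b)%g) * s)%g.
Proof. by rewrite iplusE -mul_rplus val_rplus. Qed.

Lemma down_act1 b : down_act 1%g b = b.
Proof. by rewrite /down_act mul1g iplus_val. Qed.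

Lemma down_actM m n b : down_act (m * n)%g b = down_act m (down_act n b).
Proof. by apply: EBA_val_inj; rewrite !iplusE rplus_mulr mulgA. Qed.

Lemma down_act_hom m : is_boolean_hom (down_act m).
Proof.
have actI : {morph down_act m : b c / (b `&` c)%O}.
  move=> b c; apply: EBA_val_inj; rewrite val_meet !iplusE -rplus_plus mulgA.
  by rewrite -mul_rplus val_rplus -mulgA val_meet.
have act0 : down_act m \bot%O = \bot%O.
  by rewrite /down_act -rzeroE (br_mul0 (br_ax S)); apply: iplus_val.
apply: is_boolean_hom_meet_compl => // b.
rewrite -(is_join_iplus2 (br_mulU (br_ax S) (tv m) _ (is_join_compl b))).
  by apply: EBA_val_inj; rewrite iplusE mulg1 totP val_top.
by apply/rdisj_val; exact: meetxC.
Qed.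

Lemma down_ax : is_matched_pair down_op down_act.
Proof.
split.
- move=> e; apply: (br_nondegenerate (br_ax S)).
  by rewrite rzeroE e val_top.
- exact: down_Bset.
- exact: down_act1.
- exact: down_actM.
- exact: down_act_hom.
- move=> b m n p /down_equivE h; apply/down_equivE.
  by rewrite /= !mulgA h.
- move=> b m n p /down_equivE h; apply/down_equivE.
  by rewrite /= !mulgA -mul_val_rplus -!mulgA h.
- move=> b c m n /down_equivE h; apply: EBA_val_inj.
  by rewrite !val_meet !iplusE -!val_mulP !mulgA h.
Qed.

Definition down_ob : matchedPair := MatchedPair down_ax.

End DownObject.

Section DownMorphism.
Variables (S T : brMonoid) (f : br_hom S T).

Lemma down_B_subproof (b : EBA S) : f (ev b) \in Idem T.
Proof.
have [_ fp _ _] := brh_ax f.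
by rewrite in_setE; exists (f (ev b)) => //; rewrite -fp val_rplus.
Qed.

Lemma down_M_subproof (m : TotT S) : f (tv m) \in Tot T.
Proof.
have [[f1 _] fp _ _] := brh_ax f.
by rewrite in_setE /Tot /= -fp totP.
Qed.

Definition down_B (b : EBA S) : EBA T :=
  exist (fun e => e \in Idem T) (f (ev b)) (down_B_subproof b).

Definition down_M (m : TotT S) : TotT T :=
  exist (fun s => s \in Tot T) (f (tv m)) (down_M_subproof m).

Lemma val_down_B b : ev (down_B b) = f (ev b). Proof. by []. Qed.

Lemma val_down_M m : tv (down_M m) = f (tv m). Proof. by []. Qed.

Lemma down_B_hom : is_boolean_hom down_B.
Proof.
have [[f1 fM] fp f0 fj] := brh_ax f.
apply: is_boolean_hom_meet_compl => [b c||b].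
- by apply: EBA_val_inj; rewrite val_meet !val_down_B val_meet fM.
- by apply: EBA_val_inj; rewrite val_down_B -!rzeroE f0.
- have db : rdisj (ev b) (ev (~` b)%O) by apply/rdisj_val; exact: meetxC.
  have := is_join_iplus2 (fj _ _ _ db (is_join_compl b)).
  rewrite f1 iplus1 => ->.
  by rewrite -!val_down_B !iplus_val.
Qed.

Lemma down_hom_ax : @is_mp_hom (down_ob S) (down_ob T) down_B down_M.
Proof.
have [[f1 fM] fp f0 fj] := brh_ax f.
split.
- exact: down_B_hom.
- by split=> [|m n]; apply: tv_inj; [exact: f1|exact: fM].
- move=> b m n /down_equivE h; apply/down_equivE.
  by rewrite val_down_B !val_down_M -!fM h.
- move=> m b; apply: EBA_val_inj.
  by rewrite val_down_B !iplusE fp fM.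
Qed.

Definition down_map : mp_hom (down_ob S) (down_ob T) := MpHom down_hom_ax.

End DownMorphism.

Lemma down_map1 (S : brMonoid) : down_map (br_id S) = mp_id (down_ob S).
Proof.
by apply: mp_hom_eq; apply/funext => x; apply: val_inj.
Qed.

Lemma down_mapM (S T U : brMonoid) (g : br_hom T U) (f : br_hom S T) :
  down_map (br_comp g f) = mp_comp (down_map g) (down_map f).
Proof.
by apply: mp_hom_eq; apply/funext => x; apply: val_inj.
Qed.

Definition down : functor BRMonCat MPCat :=
  @Functor BRMonCat MPCat down_ob down_map down_map1 down_mapM.

Section GrothendieckDown.
Variable S : gbrMonoid.
Implicit Types (b : EBA S) (P : set (EBA S)) (A : set S) (m : TotT S).

Local Notation "# s" := (iplus s : EBA S) (at level 5).
Local Notation J := (@gbr_J S).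

Lemma admissible_partition A j : admissible J A -> is_join A j ->
  # j = \top%O -> J ((iplus @` A : set (EBA S)) `\ \bot%O).
Proof.
move=> [_ [Q JQ AQ]] Aj j1; suff -> : (iplus @` A : set (EBA S)) `\ \bot%O = Q by [].
apply: partition_subset => //; first exact: (zd_partition (gbr_top (gbr_ax S)) JQ).
by apply/isLub_setD0; rewrite -j1; exact: is_join_iplus.
Qed.

Lemma iplus_ev_image P : iplus @` (@ev S @` P) = P.
Proof.
rewrite image_comp; apply/seteqP; split=> [_ [e Pe <-]|e Pe] /=.
  by rewrite iplus_val.
by exists e => //=; exact: iplus_val.
Qed.

Lemma partition_admissible P : J P -> admissible J (@ev S @` P).
Proof.
move=> JP; have [_ _ Pd] := zd_partition (gbr_top (gbr_ax S)) JP.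
split=> [_ _ [b Pb <-] [c Pc <-] bc|].
  by apply/rdisj_val/Pd => // bc'; apply: bc; rewrite bc'.
by exists P => //; rewrite iplus_ev_image => b [].
Qed.

Lemma partition_join P : J P -> is_join (@ev S @` P) 1%g.
Proof.
move=> JP; have [_ Plub _] := zd_partition (gbr_top (gbr_ax S)) JP.
have [j Pj] := gbr_join (gbr_ax S) (partition_admissible JP).
have j1 := is_join_lub_top Plub Pj; by rewrite j1 in Pj.
Qed.

Lemma gdown_act m : preserves_topology J J (down_act m).
Proof.
move=> P JP; have adP := partition_admissible JP.
have [adm jm] := gbr_mul (gbr_ax S) (tv m) adP.
have {}jm := jm _ (partition_join JP).
have -> : down_act m @` P = iplus @` [set (tv m * a)%g | a in @ev S @` P].
  by rewrite !image_comp.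
apply: admissible_partition adm jm _.
by rewrite mulg1; apply: EBA_val_inj; rewrite iplusE totP val_top.
Qed.

Section Glue.
Variables (P : set (EBA S)) (JP : J P).
Implicit Type x : P -> TotT S.

Let fam x : set S := range (fun b : P => (ev (val b) * tv (x b))%g).

Lemma iplus_fam x (b : P) : # (ev (val b) * tv (x b))%g = val b.
Proof. by apply: EBA_val_inj; rewrite iplusE val_mulP totP mulg1. Qed.

Lemma iplus_fam_image x : iplus @` fam x = P.
Proof.
apply/seteqP; split=> [_ [_ [b _ <-] <-]|b Pb].
  by rewrite iplus_fam; have := valP b; rewrite in_setE.
have bP : b \in P by rewrite in_setE.
exists (ev b * tv (x (exist _ b bP)))%g; last exact: (iplus_fam x (exist _ b bP)).
by exists (exist _ b bP).
Qed.

Lemma fam_admissible x : admissible J (fam x).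
Proof.
have [_ _ Pd] := zd_partition (gbr_top (gbr_ax S)) JP.
split=> [_ _ [b _ <-] [c _ <-] bc|].
  apply/rdisjE; rewrite !iplus_fam; apply: Pd.
  - by have := valP b; rewrite in_setE.
  - by have := valP c; rewrite in_setE.
  - by move=> /val_inj bc'; apply: bc; rewrite bc'.
by exists P => //; rewrite iplus_fam_image => b [].
Qed.

Lemma fam_join_total x j : is_join (fam x) j -> rplus j = 1%g.
Proof.
have [_ Plub _] := zd_partition (gbr_top (gbr_ax S)) JP.
move=> /is_join_iplus; rewrite iplus_fam_image => /(is_lub_uniq Plub) j1.
by rewrite -iplusE -j1 val_top.
Qed.

Lemma fam_join_ex x : exists z : TotT S, is_join (fam x) (tv z).
Proof.
have [j xj] := gbr_join (gbr_ax S) (fam_admissible x).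
have jT : j \in Tot S by rewrite in_setE; exact: fam_join_total xj.
by exists (exist _ j jT).
Qed.

Lemma fam_joinP x (z : TotT S) : is_join (fam x) (tv z) <->
  forall b : P, (ev (val b) * tv z)%g = (ev (val b) * tv (x b))%g.
Proof.
split=> [zx b|zx].
  have := zx.1 (ev (val b) * tv (x b))%g.
  by rewrite /rle -iplusE iplus_fam => -> //; exists b.
have [w xw] := fam_join_ex x.
suff <- : tv w = tv z by [].
apply: rle_eq; last by rewrite !totP.
apply: xw.2 => _ [b _ <-].
by rewrite /rle -iplusE iplus_fam zx.
Qed.

Lemma gdown_glue : exists g : (P -> TotT S) -> TotT S,
  [/\ forall m, g (fun=> m) = m,
      forall x y : P -> TotT S,
        g (fun b : P => down_op (val b) (x b) (y b)) = g x &
      forall (x : P -> TotT S) (b : P), down_op (val b) (g x) (x b) = x b].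
Proof.
have [g gP] := choice fam_join_ex; exists g.
have gU (x : P -> TotT S) (z : TotT S) :
    (forall b : P, (ev (val b) * tv z)%g = (ev (val b) * tv (x b))%g) ->
    g x = z.
  by move=> /fam_joinP; move/(is_join_uniq (gP x)) /tv_inj.
split=> [m|x y|x b]; first exact: gU.
- by apply: gU => b; rewrite down_opl; move: b; apply/fam_joinP.
- by apply/down_equivE; move: b; apply/fam_joinP.
Qed.

End Glue.

Lemma gdown_ax : @is_gmatched_pair (down_ob S) J.
Proof.
split; first exact: gbr_top (gbr_ax S).
  by split; [exact: down_Bset|move=> P JP _; exact: gdown_glue].
exact: gdown_act.
Qed.

Definition gdown_ob : gmatchedPair := GMatchedPair gdown_ax.

End GrothendieckDown.

Section GrothendieckDownMorphism.
Variables (S T : gbrMonoid) (f : gbr_hom S T).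

Lemma gdown_hom_ax :
  preserves_topology (@gbr_J S) (@gbr_J T) (down_B f).
Proof.
move=> P JP; have [fadm fjoin] := gbrh_ax f; have [[f1 _] _ _ _] := brh_ax f.
have adP := partition_admissible JP.
have -> : down_B f @` P = iplus @` (f @` (@ev S @` P)).
  rewrite !image_comp; apply: eq_imagel => b _ /=.
  by apply: EBA_val_inj; rewrite iplusE -val_down_B val_rplus.
apply: admissible_partition (fadm _ adP) (fjoin _ _ adP (partition_join JP)) _.
by rewrite f1 iplus1.
Qed.

Definition gdown_map : gmp_hom (gdown_ob S) (gdown_ob T) :=
  @GMpHom (gdown_ob S) (gdown_ob T) (down_map f) gdown_hom_ax.

End GrothendieckDownMorphism.

Lemma gdown_map1 (S : gbrMonoid) : gdown_map (gbr_id S) = gmp_id (gdown_ob S).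
Proof. by apply: gmp_hom_eq; apply/funext => x; apply: val_inj. Qed.

Lemma gdown_mapM (S T U : gbrMonoid) (g : gbr_hom T U) (f : gbr_hom S T) :
  gdown_map (gbr_comp g f) = gmp_comp (gdown_map g) (gdown_map f).
Proof. by apply: gmp_hom_eq; apply/funext => x; apply: val_inj. Qed.

Definition gdown : functor GBRMonCat GMPCat :=
  @Functor GBRMonCat GMPCat gdown_ob gdown_map gdown_map1 gdown_mapM.

Section FiniteTopology.
Variable B : boolAlg.
Implicit Types (P : set B) (b c x u : B).

Lemma finite_lub P : finite_set P -> exists z, isLub P z.
Proof.
move=> /finite_seqP [s ->]; exists (\join_(i <- s) i)%O; split.
  by move=> b /= bs; exact: joins_sup_seq.
by move=> u uub; apply/joinsP_seq => b bs _; exact: uub.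
Qed.

Lemma lub_disjoint P z x : isLub P z -> (forall b, P b -> (b `&` x)%O = \bot%O) ->
  (z `&` x)%O = \bot%O.
Proof.
move=> [_ zlub] h; apply/eqP; rewrite disj_leC; apply: zlub => b /h /eqP.
by rewrite disj_leC.
Qed.

Lemma finite_topology_zd : is_zd_topology (finite_topology B).
Proof.
split=> [P []//|P Pf Pp //|P Q [Pf [P0 [_ Plub] Pd]] QJ|P I alpha [Pf [P0 Plub Pd]] asurj].
- split.
    apply: finite_setD; apply: bigcup_finite => // b /QJ [Qf _].
    exact: finite_image.
  split=> [[_ /(_ erefl)]//||].
    apply/isLub_setD0; split=> [b _|u uub]; first exact: lex1.
    apply: Plub => b Pb; have [_ [_ [_ Qlub] _]] := QJ b Pb.
    have : (\top <= u `|` ~` b)%O.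
      apply: Qlub => c Qc; rewrite -[X in (X <= _)%O]meetx1 -(joinxC b) meetUr.
      rewrite leU2 ?leIr// meetC; apply: uub.
      by exists b => //; exists c.
    by rewrite le1x joinC => /eqP h; rewrite -[X in (X <= _)%O]meetx1 -h meetUr
      meetxC join0x leIr.
  move=> _ _ [[b Pb [c Qc <-]] _] [[b' Pb' [c' Qc' <-]] _] ne.
  have [e|nb] := pselect (b = b'); last by rewrite meetACA (Pd b b') // meet0x.
  subst b'; have [_ [_ _ Qd]] := QJ b Pb.
  by rewrite meetACA (Qd c c') ?meetx0 // => e; apply: ne; rewrite e.
- have fibE i : fibre alpha i `<=` P.
    by move=> _ [b _ <-]; have := valP b; rewrite in_setE.
  have fibF i : finite_set (fibre alpha i) by exact: sub_finite_set (fibE i) Pf.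
  have lubE i : exists z, isLub (fibre alpha i) z by exact: finite_lub.
  split=> //; have [z zP] := choice lubE.
  have setE : [set x | exists i, isLub (fibre alpha i) x] = range z.
    apply/seteqP; split=> [x [i xi]|_ [i _ <-]]; last by exists i.
    by exists i => //; exact: is_lub_uniq (zP i) xi.
  have PE b (bP : b \in P) : (b <= z (alpha (exist _ b bP)))%O.
    by apply: (zP _).1; exists (exist _ b bP).
  rewrite /finite_topology /= setE; split.
    have -> : range z = [set z (alpha b) | b in [set: P]].
      apply/seteqP; split=> [_ [i _ <-]|_ [b _ <-]]; last by exists (alpha b).
      by have [b <-] := asurj i; exists b.
    apply: finite_image.
    have : finite_set ([set: P] : set P).
      have -> : [set: P] = val @^-1` P.
        by apply/seteqP; split=> // b _; have := valP b; rewrite in_setE.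
      by apply: finite_preimage => // b c _ _; exact: val_inj.
    by [].
  split.
  + move=> [i _ zi0]; have [b bi] := asurj i.
    have := valP b; rewrite in_setE => Pb; apply: P0.
    suff <- : val b = \bot%O by [].
    by apply/eqP; rewrite -lex0 -zi0; apply: (zP i).1; exists b.
  + split=> [b _|u uub]; first exact: lex1.
    apply: Plub.2 => b Pb; have bP : b \in P by rewrite in_setE.
    by apply: le_trans (PE b bP) _; apply: uub; exists (alpha (exist _ b bP)).
  + move=> _ _ [i _ <-] [j _ <-] ne.
    apply: (lub_disjoint (zP i)) => _ [b bi <-].
    rewrite meetC; apply: (lub_disjoint (zP j)) => _ [c cj <-].
    have := valP b; have := valP c; rewrite !in_setE => Pc Pb.
    apply: Pd => // /val_inj cb; apply: ne.
    by move: bi cj; rewrite /= cb => -> ->.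
Qed.

Lemma finite_disjoint_extend P : finite_set P ->
  (forall c d, P c -> P d -> c <> d -> (c `&` d)%O = \bot%O) ->
  exists2 Q, finite_topology B Q & P `\ \bot%O `<=` Q.
Proof.
move=> Pf Pd; have [z zP] := finite_lub Pf.
exists ((P `|` [set (~` z)%O]) `\ \bot%O); last by move=> b [Pb b0]; split=> //; left.
split; first by apply: finite_setD; rewrite finite_setU.
split=> [[_ /(_ erefl)]//||].
  apply/isLub_setD0; split=> [b _|u uub]; first exact: lex1.
  rewrite -(joinxC z) leUx; apply/andP; split; last by apply: uub; right.
  by apply: zP.2 => b Pb; apply: uub; left.
have Pz c : P c -> (c `&` ~` z)%O = \bot%O.
  by move=> Pc; apply/eqP; rewrite disj_leC complK; exact: zP.1.
move=> c d [[Pc|->] _] [[Pd'|->] _] ne //.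
- exact: Pd.
- exact: Pz.
- by rewrite meetC Pz.
Qed.

End FiniteTopology.

Lemma boolean_hom_preserves_finite (B C : boolAlg) (f : B -> C) :
  is_boolean_hom f -> preserves_topology (finite_topology B) (finite_topology C) f.
Proof.
move=> [fI fU f0 f1 fC] P [Pf [P0 Plub Pd]]; split.
  by apply: finite_setD; exact: finite_image.
split=> [[_ /(_ erefl)]//||_ _ [[b Pb <-] _] [[c Pc <-] _] ne].
  apply/isLub_setD0; split=> [b _|u uub]; first exact: lex1.
  move: Pf Plub uub => /finite_seqP [s ->] Plub uub.
  have e : (\join_(i <- s) i)%O = \top%O :> B.
    apply: is_lub_uniq Plub; split=> [b /= bs|w wub]; first exact: joins_sup_seq.
    by apply/joinsP_seq => b bs _; exact: wub.
  rewrite -f1 -e (big_morph f fU f0).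
  by apply/joinsP_seq => b bs _; apply: uub; exists b.
by rewrite -fI Pd // => bc; apply: ne; rewrite bc.
Qed.

Section FiniteJoins.
Variable S : brMonoid.
Implicit Types (s t j x : S) (A : set S).

Lemma is_join_set0 : is_join set0 (rzero S).
Proof. by split=> // u _; exact: br_zero_le (br_ax S) u. Qed.

Lemma is_join_setU1 A x j k : is_join A j -> is_join [set x; j] k ->
  is_join (x |` A) k.
Proof.
move=> [Aj jA] [xj kx]; split=> [a [->|Aa]|u uub]; first by apply: xj; left.
  by apply: rle_trans (Aj a Aa) _; apply: xj; right.
apply: kx => _ [->|->]; first by apply: uub; left.
by apply: jA => a Aa; apply: uub; right.
Qed.

Lemma admissible_finite A :
  admissible (finite_topology (EBA S)) A <-> finite_set A /\ pairwise_rdisj A.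
Proof.
split=> [[Ad [Q [Qf _] AQ]]|[Af Ad]]; last first.
  split=> //; apply: finite_disjoint_extend; first exact: finite_image.
  move=> _ _ [a Aa <-] [b Ab <-] ab; apply/rdisjE/Ad => // ab'.
  by apply: ab; rewrite ab'.
split=> //.
pose h (e : EBA S) := xget (rzero S) [set a | A a /\ (iplus a : EBA S) = e].
apply: (@sub_finite_set _ _ (rzero S |` (h @` Q))); last first.
  by rewrite finite_setU; split=> //; exact: finite_image.
move=> a Aa; have [a0|a0] := pselect ((iplus a : EBA S) = \bot%O).
  by left; exact: iplus_eq0.
right; exists (iplus a); first by apply: AQ; split=> //; exists a.
rewrite /h; case: xgetP => [b _ [Ab ba]|/(_ a)]; last by case.
apply: contrapT => /(Ad _ _ Ab Aa) /rdisjE; rewrite ba => aa.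
by apply: a0; rewrite -aa meetxx.
Qed.

Lemma finite_join (T : brMonoid) (g : S -> T) : g (rzero S) = rzero T ->
  (forall s t, rdisj s t -> rdisj (g s) (g t)) ->
  (forall s t j, rdisj s t -> is_join [set s; t] j ->
    is_join [set g s; g t] (g j)) ->
  forall A, finite_set A -> pairwise_rdisj A ->
    (finite_set (g @` A) /\ pairwise_rdisj (g @` A)) /\
    exists2 j, is_join A j & is_join (g @` A) (g j).
Proof.
move=> g0 gd gj A Af Ad; split.
  split; first exact: finite_image.
  move=> _ _ [a Aa <-] [b Ab <-] ab; apply/gd/Ad => // ab'.
  by apply: ab; rewrite ab'.
move: Af Ad => /finite_seqP [s ->] {A}; elim: s => [|x s IH] sd.
  have -> : [set` [::]] = set0 :> set S by apply/seteqP; split.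
  by exists (rzero S); [exact: is_join_set0|rewrite image_set0 g0; split=> // u _;
    exact: br_zero_le (br_ax T) u].
have [|j sj gsj] := IH.
  by move=> a b /= sa sb; apply: sd; rewrite /= inE ?sa ?sb orbT.
have xsE : [set` x :: s] = x |` [set` s].
  apply/seteqP; split=> a /=; rewrite inE.
    by move=> /orP [/eqP ->|]; [left|right].
  by move=> [->|->]; rewrite ?eqxx ?orbT.
have [xs|xs] := boolP (x \in s).
  have -> : [set` x :: s] = [set` s].
    by rewrite xsE; apply/seteqP; split=> [a [->//|//]|a]; right.
  by exists j.
have dxj : rdisj x j.
  apply/rdisjE; rewrite meetC; apply: (lub_disjoint (is_join_iplus sj)).
  move=> _ [a sa <-]; apply/rdisjE/sd; rewrite /= ?inE ?eqxx ?orbT //.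
    by move: sa => /= ->; rewrite orbT.
  by move=> ax; move: xs; rewrite -ax; move: sa => /= ->.
have [k xjk] := br_join (br_ax S) dxj.
exists k; rewrite xsE; first exact: is_join_setU1 sj xjk.
rewrite image_setU image_set1.
have gk := gj _ _ _ dxj xjk.
case: gsj gk => [h1 h2] [h3 h4]; split=> [_ [->|[a sa <-]]|u uub].
- by apply: h3; left.
- by apply: rle_trans (h1 _ _) (h3 _ _); [exists a|right].
- apply: h4 => _ [->|->]; first by apply: uub; left.
  by apply: h2 => b sb; apply: uub; right.
Qed.

Lemma incl_br_ax : is_gbrMonoid (finite_topology (EBA S)).
Proof.
split; first exact: finite_topology_zd.
- move=> A /admissible_finite [Af Ad].
  by have [_ [j Aj _]] := @finite_join S idfun erefl (fun _ _ h => h)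
    (fun _ _ _ _ h => h) A Af Ad; exists j.
- move=> A s /admissible_finite [Af Ad].
  have sd t u : rdisj t u -> rdisj (s * t)%g (s * u)%g.
    rewrite /rdisj => tu; rewrite -[in LHS](rplus_mulr s u) -rplus_plus mulgA.
    rewrite -mul_rplus -mulgA tu (br_mul0 (br_ax S)); exact: rplus0.
  have [+ [j Aj sj]] := @finite_join S (fun t => (s * t)%g) (br_mul0 (br_ax S) s)
    sd (fun t u j => br_mulU (br_ax S) s (j := j)) A Af Ad.
  move=> /admissible_finite sA; split=> // k Ak.
  by rewrite (is_join_uniq Ak Aj).
Qed.

End FiniteJoins.

Definition incl_br_ob (S : brMonoid) : gbrMonoid := GbrMonoid (incl_br_ax S).

Lemma incl_br_hom_ax (S T : brMonoid) (f : br_hom S T) :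
  @is_gbr_hom (incl_br_ob S) (incl_br_ob T) f.
Proof.
have [_ _ f0 fj] := brh_ax f.
have fin := finite_join f0 (@br_hom_disj _ _ f) fj.
split=> [A /admissible_finite [Af Ad]|A j /admissible_finite [Af Ad] Aj].
  by apply/admissible_finite; case: (fin A Af Ad).
have [_ [k Ak fk]] := fin A Af Ad.
by rewrite (is_join_uniq Aj Ak).
Qed.

Definition incl_br_map (S T : brMonoid) (f : br_hom S T) :
  gbr_hom (incl_br_ob S) (incl_br_ob T) := GbrHom (incl_br_hom_ax f).

Definition incl_br : functor BRMonCat GBRMonCat :=
  @Functor BRMonCat GBRMonCat incl_br_ob incl_br_map
    (fun S => ltac:(by apply: gbr_hom_eq))
    (fun S T U g f => ltac:(by apply: gbr_hom_eq)).

Lemma incl_mp_ax (X : matchedPair) :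
  is_gmatched_pair (finite_topology (mpB X)).
Proof.
have [_ Bset _ _ hom _ _ _] := mp_ax X.
split; first exact: finite_topology_zd.
  by split=> // P [Pf _] /(_ Pf).
by move=> m; apply: boolean_hom_preserves_finite.
Qed.

Definition incl_mp_ob (X : matchedPair) : gmatchedPair := GMatchedPair (incl_mp_ax X).

Definition incl_mp_map (X Y : matchedPair) (h : mp_hom X Y) :
    gmp_hom (incl_mp_ob X) (incl_mp_ob Y) :=
  @GMpHom (incl_mp_ob X) (incl_mp_ob Y) h
    (boolean_hom_preserves_finite (mhp_bool (mph_ax h))).

Definition incl_mp : functor MPCat GMPCat :=
  @Functor MPCat GMPCat incl_mp_ob incl_mp_map
    (fun X => ltac:(by apply: gmp_hom_eq))
    (fun X Y Z g f => ltac:(by apply: gmp_hom_eq)).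

(* Main.v *)
From HB Require Import structures.
From mathcomp Require Import all_boot all_order.
From mathcomp Require Import boolp classical_sets functions cardinality.
Require Import Defs.

Set Implicit Arguments.
Unset Strict Implicit.
Unset Printing Implicit Defensive.

Import Order.Theory.

Local Open Scope classical_set_scope.

(** Passing from [S] to its idempotents and its total elements loses nothing:
    every [s] factors as [s = s^+ m] with [m] total, where [m] is the join of
    [s] and of the complement of [s^+] ([total_extension]). Two products [bm]
    and [bn] coincide exactly when [m] and [n] are [b]-equivalent, and
    [(bm)(cn) = (b /\ m^* c)(mn)] ([restrict_mul]). Hence [S] amounts to the set
    of pairs [(b, m)] modulo [b]-equivalence of the second component, equipped
    with operations which only mention the matched pair.

    The functor [down] is thus faithful, and it is full because a homomorphism
    [(phi, f)] of matched pairs extends to [bm |-> phi(b) f(m)] ([extend]). It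
    is essentially surjective because the same pairs, formed from an arbitrary
    matched pair, are a Boolean restriction monoid ([partial_br]) whose idempotents
    and total elements give back the matched pair ([counit]).

    With topologies, the new content is about joins. If the nonzero domains of a
    disjoint family lie in a partition [P] of the topology, then they have a
    least upper bound by coarsening of [P] ([subset_lub]), the total parts of
    the members can be glued along [P] ([partition_bs_glue]), and the element so
    obtained is the join because elements which agree on each part of [P] are
    equal ([partition_bs_eq], [subpartition_join_ex]). Such joins are preserved by
    multiplication and by the extension of homomorphisms because a Boolean
    homomorphism preserving topologies preserves the least upper bound of any
    part of a partition of the topology ([lub_preserves]). A matched pair
    without topology is the case of the finite topology, which provides its
    binary joins.

    Finally, the two composites with the inclusions given by the finite
    topologies have the same objects and the same underlying maps: they differ
    only in proofs, and proofs of a proposition are equal. *)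

(** * Equivalences from fully faithful, essentially surjective functors *)

Section FullyFaithful.
Variables (C D : category) (F : functor C D).
Hypothesis faithful : forall (X Y : C) (f g : Hom X Y), fmap F f = fmap F g -> f = g.
Hypothesis full : forall (X Y : C) (h : Hom (F X) (F Y)), exists f, fmap F f = h.
Hypothesis esurj : forall Y : D, exists (X : C) (e : Hom (F X) Y), is_iso e.

Lemma is_equivalence_ff : is_equivalence F.
Proof.
pose G0 Y := projT1 (cid (esurj Y)).
have G0P Y : exists (e : Hom (F (G0 Y)) Y), is_iso e by rewrite /G0; case: cid.
pose e Y := projT1 (cid (G0P Y)).
have eP Y : is_iso (e Y) by rewrite /e; case: cid.
pose i Y := projT1 (cid (eP Y)).
have ie Y : compm (i Y) (e Y) = idm (F (G0 Y)) by rewrite /i; case: cid => ? [].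
have ei Y : compm (e Y) (i Y) = idm Y by rewrite /i; case: cid => ? [].
pose lift X Y (h : Hom (F X) (F Y)) := projT1 (cid (full h)).
have liftK X Y (h : Hom (F X) (F Y)) : fmap F (lift X Y h) = h.
  by rewrite /lift; case: cid.
pose G1 Y Z (f : Hom Y Z) : Hom (G0 Y) (G0 Z) :=
  lift _ _ (compm (i Z) (compm f (e Y))).
have G11 Y : G1 Y Y (idm Y) = idm (G0 Y).
  by apply: faithful; rewrite liftK fmap1 comp1m ie.
have G1M (W Y Z : D) (g : Hom Y Z) (f : Hom W Y) :
    G1 _ _ (compm g f) = compm (G1 _ _ g) (G1 _ _ f).
  apply: faithful; rewrite fmapM !liftK -!compmA; congr compm.
  by rewrite [compm (e Y) _]compmA ei comp1m.
exists (@Functor D C G0 G1 G11 G1M); split.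
  exists (fun X : C => lift (G0 (F X)) X (e (F X))); split.
    move=> X Y f /=; apply: faithful.
    by rewrite !fmapM !liftK compmA ei comp1m.
  move=> X /=; exists (lift X (G0 (F X)) (i (F X))).
  by split; apply: faithful; rewrite fmapM !liftK fmap1.
exists e; split=> [Y Z f|Y]; last exact: eP.
by rewrite /= liftK compmA ei comp1m.
Qed.

End FullyFaithful.

(** * Functors which differ only in proofs *)

Lemma functor_irrelevance (C D : category) (F0 : C -> D)
    (F1 : forall X Y : C, Hom X Y -> Hom (F0 X) (F0 Y)) p pM q qM :
  @Functor C D F0 F1 p pM = @Functor C D F0 F1 q qM.
Proof. by rewrite (Prop_irrelevance p q) (Prop_irrelevance pM qM). Qed.

Section TopologisedFunctor.
Variables (C : category) (H : functor C MPCat).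
Variable J : forall S : C, set (set (mpB (H S : matchedPair))).

(** The proofs [p] that each object is a Grothendieck matched pair occur in the
    types of the morphisms and of the functor laws. Abstracting over them, and
    over the proofs [q], allows replacing them all at once. *)
Definition topologise
    (p : forall S, @is_gmatched_pair (H S) (@J S))
    (q : forall (S T : C) (f : Hom S T),
       preserves_topology (@J S) (@J T) (mph_B (fmap H f : mp_hom _ _))) :
    functor C GMPCat :=
  @Functor C GMPCat (fun S => GMatchedPair (p S))
    (fun S T f =>
       @GMpHom (GMatchedPair (p S)) (GMatchedPair (p T)) (fmap H f) (q S T f))
    (fun S => ltac:(by apply: gmp_hom_eq; rewrite /= fmap1))
    (fun S T U g f => ltac:(by apply: gmp_hom_eq; rewrite /= fmapM)).

Lemma topologise_irrelevance p q p' q' : topologise p q = topologise p' q'.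
Proof. by rewrite (Prop_irrelevance p p') (Prop_irrelevance q q'). Qed.

End TopologisedFunctor.

Lemma gdown_incl_br : functor_comp gdown incl_br = functor_comp incl_mp down.
Proof.
pose J (S : BRMonCat) := finite_topology (mpB (down S : matchedPair)).
pose p S : @is_gmatched_pair (down S) (J S) := gmp_ax (functor_comp gdown incl_br S).
pose q S T (f : Hom S T) := gmph_ax (fmap (functor_comp gdown incl_br) f).
pose p' S : @is_gmatched_pair (down S) (J S) := gmp_ax (functor_comp incl_mp down S).
pose q' S T (f : Hom S T) := gmph_ax (fmap (functor_comp incl_mp down) f).
transitivity (@topologise _ down J p q); first exact: functor_irrelevance.
rewrite (topologise_irrelevance p q p' q'); exact: functor_irrelevance.
Qed.

(** * Least upper bounds of parts of a partition *)

(** If [u] bounds the image of [D], then [u \/ f(z)'] bounds the image of the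
    whole of [P], because the members of [P] outside [D] are disjoint from [z].
    Hence [u \/ f(z)' = 1], that is, [f(z) <= u]. *)
Lemma lub_hom (B C : boolAlg) (f : B -> C) (P D : set B) (z : B) :
  is_boolean_hom f -> is_partition \top%O P -> isLub (f @` P) \top%O ->
  D `\ \bot%O `<=` P -> isLub D z -> isLub (f @` D) (f z).
Proof.
move=> [fI fU f0 f1 fC] [_ _ Pd] [_ fPlub] DP Dz; split.
  move=> _ [d Dd <-]; rewrite leEmeet -fI; apply/eqP; congr f.
  by apply/eqP; rewrite -leEmeet; exact: Dz.1.
move=> u uub; suff : (\top <= u `|` ~` f z)%O.
  by rewrite le1x => /eqP h; rewrite -[f z]meetx1 -h meetUr meetxC joinx0 leIr.
apply: fPlub => _ [p Pp <-]; have [Dp|nDp] := pselect (D p).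
  by rewrite lexU2 // uub //; exists p.
rewrite lexU2 // -fC; apply/orP; right.
rewrite leEmeet -fI; apply/eqP; congr f; apply/eqP; rewrite -leEmeet.
rewrite -disj_leC meetC; apply/eqP; apply: (lub_disjoint Dz) => d Dd.
have [->|d0] := pselect (d = \bot%O); first by rewrite meet0x.
by apply: Pd => //; [exact: DP|move=> dp; apply: nDp; rewrite -dp].
Qed.

Lemma lub_preserves (B C : boolAlg) (J : set (set B)) (K : set (set C))
    (f : B -> C) (P D : set B) (z : B) :
  is_boolean_hom f -> is_zd_topology J -> is_zd_topology K ->
  preserves_topology J K f -> J P -> D `\ \bot%O `<=` P -> isLub D z ->
  isLub (f @` D) (f z).
Proof.
move=> fb Jtop Ktop fJK JP; apply: (lub_hom (P := P)) => //.
  exact: (zd_partition Jtop JP).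
by apply/isLub_setD0; case: (zd_partition Ktop (fJK _ JP)).
Qed.

Lemma lub_meet (B : boolAlg) (D : set B) (b z : B) :
  isLub D z -> isLub [set (b `&` d)%O | d in D] (b `&` z)%O.
Proof.
move=> [Dz zD]; split=> [_ [d Dd <-]|u uub]; first by rewrite leI2 // Dz.
have : (z <= u `|` ~` b)%O.
  apply: zD => d Dd; rewrite -[d]meetx1 -(joinxC b) meetUr leU2 ?leIr //.
  by rewrite meetC; apply: uub; exists d.
move=> h; apply: le_trans (leI2 (lexx b) h) _.
by rewrite meetUr meetxC joinx0 leIr.
Qed.

(** * Full faithfulness *)

Section Extension.
Variable S : brMonoid.
Implicit Types (s t j : S) (b c : EBA S) (m n : TotT S) (A : set S).

Local Notation "# s" := (iplus s : EBA S) (at level 5).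
Local Notation v := (@ev S).

(** An upper bound lies above the join, and two comparable elements with the
    same domain are equal; so once a join is known to exist, it is recognised by
    its domain. *)
Lemma is_join_of_lub A i j : is_join A i -> (forall a, A a -> rle a j) ->
  isLub (iplus @` A : set (EBA S)) # j -> is_join A j.
Proof.
move=> Ai Aj lubj; suff <- : i = j by [].
apply: rle_eq; first exact: Ai.2.
by rewrite -!iplusE (is_lub_uniq (is_join_iplus Ai) lubj).
Qed.

(** The total element extends [s] by the identity off its domain. *)
Lemma total_extension s : exists m, s = (rplus s * tv m)%g.
Proof.
have dj : rdisj s (v (~` # s)%O) by apply/rdisjE; rewrite iplus_val meetxC.
have [j sj] := br_join (br_ax S) dj.
have jT : j \in Tot S.
  rewrite in_setE /Tot /= -iplusE (is_join_iplus2 sj) iplus_val.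
  by rewrite joinxC val_top.
exists (exist _ j jT); rewrite (join_restrict sj) //; by left.
Qed.

Definition totalise s : TotT S := projT1 (cid (total_extension s)).

Lemma totaliseP s : (rplus s * tv (totalise s))%g = s.
Proof. by rewrite /totalise; case: cid => m /= <-. Qed.

Lemma iplus_restrict b m : # (v b * tv m)%g = b.
Proof. by apply: EBA_val_inj; rewrite iplusE val_mulP totP mulg1. Qed.

Lemma totalise_restrict b m :
  (v b * tv (totalise (v b * tv m)%g))%g = (v b * tv m)%g.
Proof.
by have := totaliseP (v b * tv m)%g; rewrite -iplusE iplus_restrict.
Qed.

Lemma restrict_mul b c m n :
  (v b * tv m * (v c * tv n) = v (b `&` down_act m c)%O * tv (m * n))%g.
Proof.
by rewrite -mulgA [in LHS](mulgA (tv m)) mul_val_rplus val_meet /= !mulgA.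
Qed.

End Extension.

Section ExtendHom.
Variables (S T : brMonoid) (h : mp_hom (down_ob S) (down_ob T)).
Implicit Types (s t j : S) (b c : EBA S) (m n : TotT S) (A : set S).

Let phi : EBA S -> EBA T := mph_B h.
Let f : TotT S -> TotT T := mph_M h.

(** This is [bm |-> phi(b) f(m)], read off the factorisation
    [s = s^+ (totalise s)]; by [extend_restrict] any other total extension of [s]
    gives the same value. *)
Definition extend s : T := (ev (phi (iplus s)) * tv (f (totalise s)))%g.

Lemma extend_restrict b m :
  extend (ev b * tv m)%g = (ev (phi b) * tv (f m))%g.
Proof.
rewrite /extend iplus_restrict; apply/down_equivE.
by apply: (mhp_equiv (mph_ax h)); apply/down_equivE; exact: totalise_restrict.
Qed.

Lemma iplus_extend s : iplus (extend s) = phi (iplus s) :> EBA T.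
Proof. exact: iplus_restrict. Qed.

Lemma extend_mul s t : extend (s * t)%g = (extend s * extend t)%g.
Proof.
have [phib fM _ ha] := mph_ax h.
rewrite -[in LHS](totaliseP s) -[in LHS](totaliseP t) -!iplusE restrict_mul.
rewrite extend_restrict /extend restrict_mul; congr (ev _ * tv _)%g; last exact: fM.2.
by rewrite [LHS](bh_meet phib); congr (_ `&` _)%O; exact/esym/ha.
Qed.

Lemma extend_ev b : extend (ev b) = ev (phi b).
Proof.
have [_ fM _ _] := mph_ax h.
have -> : ev b = (ev b * tv (1 : TotT S))%g by rewrite /= mulg1.
by rewrite extend_restrict [f 1%g]fM.1 mulg1.
Qed.

Lemma extend_tv m : extend (tv m) = tv (f m).
Proof.
have [phib _ _ _] := mph_ax h.
have -> : tv m = (ev (\top%O : EBA S) * tv m)%g by rewrite val_top mul1g.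
by rewrite extend_restrict [phi _](bh_top phib) val_top mul1g.
Qed.

Lemma extend_rplus : {morph extend : s / rplus s}.
Proof. by move=> s; rewrite -!iplusE extend_ev iplus_extend. Qed.

Lemma extend_rle s j : rle s j -> rle (extend s) (extend j).
Proof. by rewrite /rle -extend_rplus -extend_mul => ->. Qed.

Lemma extend_iplus_image A :
  iplus @` (extend @` A) = phi @` (iplus @` A : set (EBA S)) :> set (EBA T).
Proof. by rewrite !image_comp; apply: eq_imagel => a _ /=; exact: iplus_extend. Qed.

Lemma extend_rdisj s t : rdisj s t -> rdisj (extend s) (extend t).
Proof.
have [phib _ _ _] := mph_ax h.
rewrite !rdisjE !iplus_extend => /(congr1 phi).
by rewrite [phi _](bh_meet phib) [phi _](bh_bot phib).
Qed.

Lemma extend_br_hom : is_br_hom extend.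
Proof.
have [phib fM _ ha] := mph_ax h; split.
- split; last exact: extend_mul.
  by rewrite -(val_top S) extend_ev [phi _](bh_top phib) val_top.
- exact: extend_rplus.
- by rewrite !rzeroE extend_ev [phi _](bh_bot phib).
move=> s t j st stj; have [i ij] := br_join (br_ax T) (extend_rdisj st).
apply: is_join_of_lub ij _ _.
  by move=> _ [->|->]; apply/extend_rle/stj.1; [left|right].
rewrite image_setU !image_set1 !iplus_extend (is_join_iplus2 stj).
rewrite [phi (_ `|` _)%O](bh_join phib); split.
  by move=> _ [->|->]; rewrite ?leUl ?leUr.
by move=> u uub; rewrite leUx; apply/andP; split; apply: uub; [left|right].
Qed.

Definition extend_hom : br_hom S T := BrHom extend_br_hom.

Lemma down_map_extend : down_map extend_hom = h.
Proof.
apply: mp_hom_eq; apply/funext => x.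
  by apply: EBA_val_inj; rewrite val_down_B; exact: extend_ev.
by apply: tv_inj; rewrite val_down_M; exact: extend_tv.
Qed.

End ExtendHom.

Lemma down_faithful (S T : brMonoid) (f g : br_hom S T) :
  down_map f = down_map g -> f = g.
Proof.
move=> e; apply: br_hom_eq; apply/funext => s.
have [[_ fM] _ _ _] := brh_ax f; have [[_ gM] _ _ _] := brh_ax g.
rewrite -(totaliseP s) -iplusE fM gM; congr (_ * _)%g.
  rewrite -!val_down_B; congr ev.
  exact: (congr1 (@^~ (iplus s)) (congr1 (@mph_B _ _) e)).
rewrite -!val_down_M; congr tv.
exact: (congr1 (@^~ (totalise s)) (congr1 (@mph_M _ _) e)).
Qed.

Section ExtendGrothendieckHom.
Variables (S T : gbrMonoid) (h : gmp_hom (gdown_ob S) (gdown_ob T)).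

Lemma extend_gbr_hom : is_gbr_hom (extend_hom h).
Proof.
have phib : is_boolean_hom (mph_B h : EBA S -> EBA T) := mhp_bool (mph_ax h).
have ext_adm A : admissible (@gbr_J S) A ->
    admissible (@gbr_J T) (extend_hom h @` A).
  move=> [Ad [P JP AP]]; split.
    move=> _ _ [a Aa <-] [b Ab <-] ab; apply/extend_rdisj/Ad => // e.
    by apply: ab; rewrite e.
  exists ((mph_B h @` P) `\ \bot%O); first exact: gmph_ax h _ JP.
  rewrite extend_iplus_image => _ [[a Aa <-] a0]; split=> //; exists a => //.
  by apply: AP; split=> // e; apply: a0; rewrite e /= (bh_bot phib).
split=> // A j Aadm Aj.
have [i Ai] := gbr_join (gbr_ax T) (ext_adm _ Aadm).
apply: is_join_of_lub Ai _ _.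
  by move=> _ [a Aa <-]; apply/extend_rle/Aj.1.
have [_ [P JP AP]] := Aadm.
rewrite extend_iplus_image iplus_extend.
apply: (lub_preserves phib _ _ (gmph_ax h) JP AP); last exact: is_join_iplus.
  exact: gbr_top (gbr_ax S).
exact: gbr_top (gbr_ax T).
Qed.

Definition extend_ghom : gbr_hom S T := GbrHom extend_gbr_hom.

Lemma gdown_map_extend : gdown_map extend_ghom = h.
Proof.
have e := down_map_extend h.
by apply: gmp_hom_eq; rewrite /= -[in RHS]e.
Qed.

End ExtendGrothendieckHom.

Lemma gdown_faithful (S T : gbrMonoid) (f g : gbr_hom S T) :
  gdown_map f = gdown_map g -> f = g.
Proof.
move=> e; apply: gbr_hom_eq; congr brh_fun; apply: down_faithful.
exact: (congr1 (@gmph (gdown_ob S) (gdown_ob T)) e).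
Qed.

(** * Locality and gluing in a B-set *)

Section Bset.
Variables (B : boolAlg) (X : Type) (op : B -> X -> X -> X).
Hypothesis opB : is_Bset op.
Implicit Types (b c : B) (x y z : X).

Lemma bs_equiv_refl b x : bs_equiv op b x x.
Proof. exact: bs_diag opB b x. Qed.

Lemma bs_equiv_sym b x y : bs_equiv op b x y -> bs_equiv op b y x.
Proof. by rewrite /bs_equiv => <-; rewrite (bs_left opB) (bs_diag opB). Qed.

Lemma bs_equiv_trans b x y z :
  bs_equiv op b x y -> bs_equiv op b y z -> bs_equiv op b x z.
Proof. by rewrite /bs_equiv => <-; rewrite (bs_left opB). Qed.

Lemma bs_equiv_opl b x y : bs_equiv op b (op b x y) x.
Proof. by rewrite /bs_equiv (bs_left opB) (bs_diag opB). Qed.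

Lemma bs_equiv_opr b x y : bs_equiv op (~` b)%O (op b x y) y.
Proof. by rewrite /bs_equiv (bs_compl opB) (bs_right opB) (bs_diag opB). Qed.

Lemma bs_equiv_le b c x y : (b <= c)%O -> bs_equiv op c x y -> bs_equiv op b x y.
Proof.
rewrite leEmeet /bs_equiv => /eqP <- h.
by rewrite (bs_meet opB) h (bs_diag opB).
Qed.

Lemma bs_equiv_join b c x y :
  bs_equiv op b x y -> bs_equiv op c x y -> bs_equiv op (b `|` c)%O x y.
Proof.
rewrite /bs_equiv => hb hc.
by rewrite -[(b `|` c)%O]complK (bs_compl opB) complU (bs_meet opB) !(bs_compl opB) hc.
Qed.

Lemma bs_equiv_bot x y : bs_equiv op \bot%O x y.
Proof. by rewrite /bs_equiv -compl1 (bs_compl opB) (bs_top opB). Qed.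

Lemma bs_equiv_top x y : bs_equiv op \top%O x y -> x = y.
Proof. by rewrite /bs_equiv (bs_top opB). Qed.

(** The element [z] is arbitrary, so [op b x z] is a canonical representative of
    the [b]-class of [x]. *)
Lemma bs_equivP b x y z : bs_equiv op b x y <-> op b x z = op b y z.
Proof.
split=> [<-|e]; first by rewrite (bs_left opB).
apply: bs_equiv_trans (bs_equiv_opl b y z).
by rewrite -e; apply: bs_equiv_sym; exact: bs_equiv_opl.
Qed.

Lemma bs_equiv_disj b c x y :
  (b `&` c)%O = \bot%O -> bs_equiv op b (op c x y) y.
Proof.
by move=> /eqP; rewrite disj_leC => bc; apply: bs_equiv_le bc (bs_equiv_opr c x y).
Qed.

Section Partition.
Variables (J : set (set B)) (P : set B).
Hypotheses (Jtop : is_zd_topology J) (JX : is_BJset J op) (JP : J P).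

(** For an infinite partition this is the uniqueness of gluing. For a finite
    one, [b]-equivalence and [c]-equivalence give [(b \/ c)]-equivalence, so that
    [x] and [y] are [1]-equivalent. *)
Lemma partition_bs_eq x y : (forall p, P p -> bs_equiv op p x y) -> x = y.
Proof.
move=> xy; have [Pf|Pi] := pselect (finite_set P); last first.
  have [g [g1 g2 _]] := JX.2 P JP Pi.
  rewrite -(g1 x) -(g2 (fun=> x) (fun=> y)) -[RHS]g1; congr g; apply/funext => p.
  by apply: xy; have := valP p; rewrite in_setE.
have [_ Plub _] := zd_partition Jtop JP.
move: Pf Plub xy => /finite_seqP [s ->] slub xy; apply: bs_equiv_top.
have -> : \top%O = (\join_(i <- s) i)%O :> B.
  apply: is_lub_uniq slub _; split=> [b /= bs|w wub]; first exact: joins_sup_seq.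
  by apply/joinsP_seq => b bs _; exact: wub.
elim: s xy {slub} => [|b s IH] xy; first by rewrite big_nil; exact: bs_equiv_bot.
rewrite big_cons; apply: bs_equiv_join; first by apply: xy; rewrite /= inE eqxx.
by apply: IH => p ps; apply: xy; rewrite /= inE; apply/orP; right.
Qed.

(** For a finite partition the gluing is iterated from the binary operation
    [op b], which leaves its second argument unchanged on everything disjoint
    from [b]. *)
Lemma partition_bs_glue (x : B -> X) : exists z, forall p, P p -> bs_equiv op p z (x p).
Proof.
have [_ _ Pd] := zd_partition Jtop JP.
have [Pf|Pi] := pselect (finite_set P); last first.
  have [g [_ _ g3]] := JX.2 P JP Pi.
  exists (g (x \o val)) => p Pp; have pP : p \in P by rewrite in_setE.
  exact: (g3 (x \o val) (exist _ p pP)).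
move: Pf Pd => /finite_seqP [s ->]; elim: s => [|b s IH] sd; first by exists (x \bot%O).
have [|z zP] := IH.
  by move=> c d cs ds; apply: sd; rewrite /= inE; apply/orP; right.
exists (op b (x b) z) => p /=; rewrite inE.
have [-> _|pb /= ps] := eqVneq p b; first exact: bs_equiv_opl.
apply: bs_equiv_trans (zP _ ps); apply: bs_equiv_disj; apply: sd => /=.
- by rewrite inE ps orbT.
- by rewrite inE eqxx.
- exact/eqP.
Qed.

(** The elements [op z x y] and [y] agree on every part of [P], hence are equal:
    on the parts in [D] by assumption, and on the others because these are
    disjoint from [z]. *)
Lemma bs_equiv_lub (D : set B) (z : B) x y : D `\ \bot%O `<=` P -> isLub D z ->
  (forall d, D d -> bs_equiv op d x y) -> bs_equiv op z x y.
Proof.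
move=> DP Dz xy; have [_ _ Pd] := zd_partition Jtop JP.
apply: partition_bs_eq => p Pp; have [Dp|nDp] := pselect (D p).
  apply: bs_equiv_trans (xy p Dp); apply: bs_equiv_le (Dz.1 p Dp) _.
  exact: bs_equiv_opl.
apply: bs_equiv_disj; rewrite meetC; apply: (lub_disjoint Dz) => d Dd.
have [->|d0] := pselect (d = \bot%O); first by rewrite meet0x.
by apply: Pd => //; [exact: DP|move=> dp; apply: nDp; rewrite -dp].
Qed.

(** The least upper bound is a block of a coarsening of [P], whose other block
    is made of the parts outside [D]. *)
Lemma subset_lub (D : set B) : D `<=` P -> exists z : B, isLub D z.
Proof.
move=> DP; pose g (p : P) := `[< D (val p) >].
(* An empty block has no place in a coarsening: the index type keeps only the
   truth values which are taken. *)
pose I := {i | exists p, g p = i}.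
pose a (p : P) : I := exist _ (g p) (ex_intro _ p erefl).
have [|+ _] := @zd_coarsen _ _ Jtop P I a JP.
  move=> [i [p e]]; exists p; rewrite /a; case: _ / e.
  by congr exist.
have [[d Dd] lub|nD _] := pselect (exists d, D d); last first.
  exists \bot%O; split=> [d Dd|u _]; last exact: le0x.
  by case: nD; exists d.
have dP : d \in P by rewrite in_setE; exact: DP.
have [z zP] := lub (a (exist _ d dP)); exists z.
suff -> : D = fibre a (a (exist _ d dP)) by [].
apply/seteqP; split=> [c Dc|_ [c /= /(congr1 (@proj1_sig _ _)) /= e <-]].
  have cP : c \in P by rewrite in_setE; exact: DP.
  exists (exist _ c cP) => //; apply: eq_exist => /=.
  by rewrite /g /= !asboolT.
by apply/asboolP; rewrite -/(g c) e; apply/asboolP.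
Qed.

End Partition.
End Bset.

(** * The restriction monoid of a matched pair *)

Section PartialMonoid.
Variable X : matchedPair.
Implicit Types (b c d : mpB X) (m n p : mpM X).

Local Notation op := (@mp_op X).
Local Notation act := (@mp_act X).

Let XB : is_Bset op := mpp_Bset (mp_ax X).

(** The pair [(b, m)] with [op b m 1 = m] stands for the pair of [b] and of the
    [b]-class of [m]: this class is represented by its unique member which is
    [b']-equivalent to [1]. Using representatives avoids a quotient and gives a
    subtype, with the inherited choice structure. *)
Definition partial : Type := {q : mpB X * mpM X | op q.1 q.2 1%g == q.2}.

HB.instance Definition _ := SubChoice.on partial.

Implicit Types s t u : partial.

Definition dom s : mpB X := (sval s).1.
Definition tot_ext s : mpM X := (sval s).2.

Lemma restr_subproof b m : op b (op b m 1%g) 1%g == op b m 1%g.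
Proof. by apply/eqP; exact: bs_left XB _ _ _ _. Qed.

Definition restr b m : partial :=
  exist (fun q => op q.1 q.2 1%g == q.2) (b, op b m 1%g) (restr_subproof b m).

Lemma restrK s : restr (dom s) (tot_ext s) = s.
Proof.
by case: s => [[b m] e]; have /eqP /= me := e; apply: val_inj; rewrite /= me.
Qed.

Lemma restr_eq b c m n : restr b m = restr c n <-> b = c /\ bs_equiv op b m n.
Proof.
split=> [/(congr1 val) [<- e]|[<- /(bs_equivP XB _ _ _ 1%g) e]]; last first.
  by apply: val_inj => /=; rewrite e.
by split=> //; apply/(bs_equivP XB _ _ _ 1%g).
Qed.

Lemma tot_ext_restr b m : bs_equiv op b (tot_ext (restr b m)) m.
Proof. exact: bs_equiv_opl. Qed.

Definition partial_mul s t :=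
  restr (dom s `&` act (tot_ext s) (dom t))%O (tot_ext s * tot_ext t)%g.

(** The product does not depend on the chosen representatives; the three
    compatibility conditions between [M] and [B] each serve once here. *)
Lemma mul_restr b c m n :
  partial_mul (restr b m) (restr c n) = restr (b `&` act m c)%O (m * n)%g.
Proof.
have [_ _ _ _ _ actr actl acte] := mp_ax X.
apply/restr_eq; have e : (b `&` act (tot_ext (restr b m)) c = b `&` act m c)%O.
  exact/acte/tot_ext_restr.
rewrite [dom _]/= [dom _]/=; split; first exact: e.
rewrite e; apply: (bs_equiv_trans XB (y := (m * tot_ext (restr c n))%g)).
  by apply: (bs_equiv_le XB (leIl _ _)); exact/actr/tot_ext_restr.
by apply: (bs_equiv_le XB (leIr _ _)); exact/actl/tot_ext_restr.
Qed.

Definition partial_one := restr \top%O 1%g.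

Lemma partial_mulA : associative partial_mul.
Proof.
move=> s t u; rewrite -(restrK s) -(restrK t) -(restrK u) !mul_restr mulgA.
congr restr; rewrite (bh_meet (mpp_hom (mp_ax X) _)) meetA.
by rewrite (mpp_actM (mp_ax X)).
Qed.

Lemma partial_mul1g : left_id partial_one partial_mul.
Proof.
by move=> s; rewrite -(restrK s) mul_restr mul1g (mpp_act1 (mp_ax X)) meet1x.
Qed.

Lemma partial_mulg1 : right_id partial_one partial_mul.
Proof.
move=> s; rewrite -(restrK s) mul_restr mulg1.
by rewrite (bh_top (mpp_hom (mp_ax X) _)) meetx1.
Qed.

HB.instance Definition _ :=
  isMonoid.Build partial partial_mulA partial_mul1g partial_mulg1.

Lemma restrM b c m n : (restr b m * restr c n)%g = restr (b `&` act m c)%O (m * n)%g.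
Proof. exact: mul_restr. Qed.

Definition partial_plus s := restr (dom s) 1%g.

Lemma restr1M b c m : (restr b 1 * restr c m)%g = restr (b `&` c)%O m.
Proof. by rewrite restrM (mpp_act1 (mp_ax X)) mul1g. Qed.

Lemma partial_plus_mul s : (partial_plus s * s)%g = s.
Proof. by rewrite -(restrK s) restr1M meetxx. Qed.

Lemma partial_plus_plus s t :
  partial_plus (partial_plus s * t)%g = (partial_plus s * partial_plus t)%g.
Proof. by rewrite /partial_plus -[in LHS](restrK t) !restr1M. Qed.

Lemma partial_plusC s t :
  (partial_plus s * partial_plus t = partial_plus t * partial_plus s)%g.
Proof. by rewrite /partial_plus !restr1M meetC. Qed.

Lemma partial_mul_plus s t :
  (s * partial_plus t = partial_plus (s * t) * s)%g.
Proof.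
rewrite /partial_plus -(restrK s) -(restrK t) !restrM mulg1 mul1g.
by rewrite (mpp_act1 (mp_ax X)) meetAC meetxx.
Qed.

Definition partial_rm : restrMonoid :=
  RestrMonoid partial_plus_mul partial_plus_plus partial_plusC partial_mul_plus.

Lemma rle_restr b c m n : rle (restr b m : partial_rm) (restr c n) <->
  (b <= c)%O /\ bs_equiv op b m n.
Proof.
rewrite /rle [rplus _]/= restr1M; split=> [/restr_eq [bc e]|[/meet_idPl bc e]].
  rewrite bc in e; split; last exact: bs_equiv_sym e.
  exact/meet_idPl.
by rewrite bc; apply/restr_eq; split=> //; exact: bs_equiv_sym e.
Qed.

(** The idempotents are the restrictions of [1], in bijection with [B] through
    their domain; the Boolean algebra structure is transported along this
    bijection. *)
Definition idem_partial : Type := Idem partial_rm.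

HB.instance Definition _ := Choice.on idem_partial.

Definition idom (e : idem_partial) : mpB X := dom (val e).

Lemma restr_dom_idem s : Idem partial_rm s -> restr (dom s) 1%g = s.
Proof. by move=> [t _ <-]. Qed.

Lemma idem_restr_subproof b : restr b 1%g \in Idem partial_rm.
Proof. by rewrite in_setE; exists (restr b 1%g). Qed.

Definition idem_restr b : idem_partial :=
  exist (fun e => e \in Idem partial_rm) (restr b 1%g) (idem_restr_subproof b).

Lemma idem_restrK : cancel idem_restr idom.
Proof. by []. Qed.

Lemma idomK : cancel idom idem_restr.
Proof.
by move=> [e eI]; apply: val_inj; apply: restr_dom_idem; rewrite -in_setE.
Qed.

Let idem_le (e f : idem_partial) : bool := (idom e <= idom f)%O.

Let idem_le_refl : reflexive idem_le.
Proof. by move=> e; exact: lexx. Qed.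

Let idem_le_anti : antisymmetric idem_le.
Proof. by move=> e f /le_anti /(can_inj idomK). Qed.

Let idem_le_trans : transitive idem_le.
Proof. by move=> f e g; exact: le_trans. Qed.

HB.instance Definition _ :=
  Order.Le_isPOrder.Build ba_disp idem_partial
    idem_le_refl idem_le_anti idem_le_trans.

Let idem_le_mono : {mono idom : e f / (e <= f)%O}.
Proof. by []. Qed.

HB.instance Definition _ := Order.IsoDistrLattice.Build ba_disp idem_partial
  idomK idem_restrK idem_le_mono.

Let idem_bot_le (e : idem_partial) : (idem_restr \bot%O <= e)%O.
Proof. exact: (le0x (idom e)). Qed.

Let idem_le_top (e : idem_partial) : (e <= idem_restr \top%O)%O.
Proof. exact: (lex1 (idom e)). Qed.

HB.instance Definition _ := Order.hasBottom.Build ba_disp idem_partial idem_bot_le.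
HB.instance Definition _ := Order.hasTop.Build ba_disp idem_partial idem_le_top.

Let idem_compl (e : idem_partial) : idem_partial := idem_restr (~` idom e)%O.

Let idem_joinxC (e : idem_partial) : (e `|` idem_compl e)%O = \top%O.
Proof. by apply: (can_inj idomK); exact: (joinxC (idom e)). Qed.

Let idem_meetxC (e : idem_partial) : (e `&` idem_compl e)%O = \bot%O.
Proof. by apply: (can_inj idomK); exact: (meetxC (idom e)). Qed.

HB.instance Definition _ := Order.TBDistrLattice_hasComplement.Build ba_disp
  idem_partial idem_joinxC idem_meetxC.

Definition partial_data : brMonoidData :=
  @BrMonoidData partial_rm (Order.CTBDistrLattice.on idem_partial).

Lemma idomE : is_boolean_hom (idom : EBA partial_data -> mpB X).
Proof. by split. Qed.

End PartialMonoid.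

Lemma rle_mul2l (S : restrMonoid) (s a j : S) : rle a j -> rle (s * a)%g (s * j)%g.
Proof. by rewrite /rle => aj; rewrite mulgA -mul_rplus -mulgA aj. Qed.

(** * Joins in the restriction monoid of a matched pair *)

Section PartialJoins.
Variables (X : matchedPair) (J : set (set (mpB X))).
Hypothesis gX : is_gmatched_pair J.
Implicit Types (s t u j : partial X) (A : set (partial X)).

Local Notation op := (@mp_op X).
Local Notation S := (partial_data X).

Let XB : is_Bset op := mpp_Bset (mp_ax X).
Let Jtop := gmpp_top gX.
Let JX := gmpp_BJset gX.

Lemma rle_dom s t : rle (s : S) t <->
  (dom s <= dom t)%O /\ bs_equiv op (dom s) (tot_ext s) (tot_ext t).
Proof. by rewrite -{1}(restrK s) -{1}(restrK t); exact: rle_restr. Qed.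

Lemma dom_mul s t :
  dom (s * t)%g = (dom s `&` mp_act (tot_ext s) (dom t))%O.
Proof. by []. Qed.

Lemma partial_rdisj s t : @rdisj S s t <-> (dom s `&` dom t)%O = \bot%O.
Proof.
suff -> : @rdisj S s t =
    (restr (dom s `&` dom t)%O 1%g = restr \bot%O 1%g :> partial X).
  by split=> [/restr_eq []|->].
by rewrite -restr1M.
Qed.

(** The part of admissibility which is not disjointness. It is stated with
    domains in [B], so that the same results apply to any topology on [B], the
    finite one included, before it is transported to the idempotents. *)
Definition subpartition A := exists2 P, J P & (@dom X @` A) `\ \bot%O `<=` P.

(** Any other upper bound has the same total part as [j] on each domain of a
    member, hence on the domain of [j] by [bs_equiv_lub]. *)
Lemma subpartition_join A j : subpartition A -> (forall a, A a -> rle (a : S) j) ->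
  isLub (@dom X @` A) (dom j) -> @is_join S A j.
Proof.
move=> [P JP AP] Aj lubj; split=> // u Au; apply/rle_dom.
split; first by apply: lubj.2 => _ [a /Au /rle_dom [+ _] <-].
apply: (bs_equiv_lub XB Jtop JX JP AP lubj) => _ [a Aa <-].
have /rle_dom [_ aj] := Aj a Aa; have /rle_dom [_ au] := Au a Aa.
exact: (bs_equiv_trans XB (bs_equiv_sym XB aj) au).
Qed.

(** The candidate has as domain the least upper bound of the domains, and as
    total part a gluing of the total parts of the members. *)
Lemma subpartition_join_ex A : subpartition A -> @pairwise_rdisj S A ->
  exists2 j, @is_join S A j & isLub (@dom X @` A) (dom j).
Proof.
move=> Asp Ad; have [P JP AP] := Asp.
have [z] := subset_lub Jtop JP AP; rewrite isLub_setD0 => zP.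
(* By disjointness at most one member has a given nonzero domain. *)
pose x p := xget 1%g [set m | exists2 a, A a & dom a = p /\ tot_ext a = m].
have [m mP] := partition_bs_glue XB Jtop JX JP x.
suff Aj a : A a -> rle (a : S) (restr z m).
  by exists (restr z m) => //; apply: subpartition_join.
move=> Aa; apply/rle_dom; split; first by apply: zP.1; exists a.
have [->|a0] := pselect (dom a = \bot%O); first exact: bs_equiv_bot.
have dz : (dom a <= z)%O by apply: zP.1; exists a.
apply: (bs_equiv_trans XB (y := m)); last first.
  by apply: (bs_equiv_sym XB); apply: (bs_equiv_le XB dz); exact: tot_ext_restr.
apply: (bs_equiv_sym XB).
have -> : tot_ext a = x (dom a).
  rewrite /x; case: xgetP => [n _ [b Ab [ba <-]]|/(_ (tot_ext a))]; last first.
    by case; exists a.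
  congr tot_ext; apply: contrapT => ab; apply: a0.
  by have /partial_rdisj := Ad _ _ Aa Ab ab; rewrite ba meetxx.
by apply: mP; apply: AP; split=> //; exists a.
Qed.

Lemma dom_mul_image A s : @dom X @` [set (s * a)%g | a in A] =
  [set (dom s `&` d)%O | d in mp_act (tot_ext s) @` (@dom X @` A)].
Proof. by rewrite !image_comp. Qed.

(** The domains of [sA] are the [d /\ m^* c], for [d] the domain and [m] the
    total part of [s], and [c] in the domains of [A]. They belong to the common
    refinement of the image of the partition under [m^*] and of [{d, d'}]. *)
Lemma subpartition_mul A s : subpartition A -> subpartition [set (s * a)%g | a in A].
Proof.
have hs := mpp_hom (mp_ax X) (tot_ext s).
move=> [P JP AP]; have JsP := gmpp_act gX (tot_ext s) JP.
pose Q (c : mpB X) : set (mpB X) := [set dom s; (~` dom s)%O] `\ \bot%O.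
have JQ b : J (Q b).
  apply: (zd_finite Jtop); first by apply: finite_setD; rewrite finite_setU.
  split=> [[_ /(_ erefl)]//||].
    apply/isLub_setD0; split=> [c _|u uub]; first exact: lex1.
    by rewrite -(joinxC (dom s)) leUx; apply/andP; split; apply: uub; [left|right].
  by move=> c d [[->|->] _] [[->|->] _] // _; rewrite ?meetxC // meetC meetxC.
have JR := zd_refine Jtop JsP (fun b _ => JQ b); eexists; first exact: JR.
rewrite dom_mul_image => _ [[_ [_ [a Aa <-] <-] <-] sa0]; split=> //.
have a0 : mp_act (tot_ext s) (dom a) <> \bot%O.
  by move=> e; apply: sa0; rewrite /= e meetx0.
exists (mp_act (tot_ext s) (dom a)).
  split=> //; exists (dom a) => //; apply: AP; split; first by exists a.
  by move=> e; apply: a0; rewrite e /= (bh_bot hs).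
exists (dom s); last by rewrite meetC.
by split; [left|move=> e; apply: sa0; rewrite /= e meet0x].
Qed.

Lemma pairwise_rdisj_mul A s : @pairwise_rdisj S A ->
  @pairwise_rdisj S [set (s * a)%g | a in A].
Proof.
have hs := mpp_hom (mp_ax X) (tot_ext s).
move=> Ad _ _ [a Aa <-] [b Ab <-] ab; apply/partial_rdisj.
rewrite !dom_mul meetACA -(bh_meet hs).
have /partial_rdisj -> : @rdisj S a b by apply: Ad => // e; apply: ab; rewrite e.
by rewrite (bh_bot hs) meetx0.
Qed.

Lemma subpartition_join_mul A s j : subpartition A -> @pairwise_rdisj S A ->
  @is_join S A j -> @is_join S [set (s * a)%g | a in A] (s * j)%g.
Proof.
have hs := mpp_hom (mp_ax X) (tot_ext s).
move=> Asp Ad Aj; apply: subpartition_join; first exact: subpartition_mul.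
  by move=> _ [a Aa <-]; apply: rle_mul2l; exact: Aj.1.
have [i Ai lubi] := subpartition_join_ex Asp Ad.
have {Ai} ij := is_join_uniq Ai Aj; rewrite ij in lubi.
rewrite dom_mul_image dom_mul; apply: lub_meet; have [P JP AP] := Asp.
exact: (lub_preserves hs Jtop Jtop (gmpp_act gX (tot_ext s)) JP AP).
Qed.

End PartialJoins.

Section PartialBoolean.
Variable X : matchedPair.
Implicit Types (s t u j : partial X).

Local Notation S := (partial_data X).

Let finX := incl_mp_ax X.

(** A finite disjoint family extends to a finite partition, so that the results
    on joins apply to binary joins with the finite topology. *)
Lemma pair_subpartition s t : @rdisj S s t ->
  subpartition (finite_topology (mpB X)) [set s; t] /\ @pairwise_rdisj S [set s; t].
Proof.
move=> st; have pd : @pairwise_rdisj S [set s; t].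
  move=> a b [->|->] [->|->] ab //; apply/partial_rdisj.
  by rewrite meetC; apply/partial_rdisj.
split=> //; apply: finite_disjoint_extend.
  by apply: finite_image; rewrite finite_setU.
move=> _ _ [a Aa <-] [b Ab <-] ab; apply/partial_rdisj/pd => // e.
by apply: ab; rewrite e.
Qed.

Lemma partial_brMonoid : is_brMonoid S.
Proof.
split.
- move=> e f; rewrite -[in X in _ <-> X](idomK e) -[in X in _ <-> X](idomK f).
  split=> [ef|/rle_restr []//]; apply/rle_restr; split=> //.
  exact: bs_equiv_refl (mpp_Bset (mp_ax X)) _ _.
- move=> s; apply/rle_dom; split; first exact: le0x.
  exact: bs_equiv_bot (mpp_Bset (mp_ax X)) _ _.
- move=> s t /pair_subpartition [sp pd].
  by have [j] := subpartition_join_ex finX sp pd; exists j.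
- move=> s; rewrite -(restrK s); apply: (etrans (restrM _ _ _ _)).
  rewrite (bh_bot (mpp_hom (mp_ax X) _)) meetx0; apply/restr_eq; split=> //.
  exact: bs_equiv_bot (mpp_Bset (mp_ax X)) _ _.
- move=> s t u j /pair_subpartition [sp pd] /(subpartition_join_mul finX s sp pd).
  by rewrite image_setU !image_set1.
- by move=> /restr_eq [/(mpp_nondegenerate (mp_ax X))].
Qed.

Definition partial_br : brMonoid := BrMonoid partial_brMonoid.

End PartialBoolean.

(** * Transport of a topology along an isomorphism *)

Section TopologyTransport.
Variables (C B : boolAlg) (f : C -> B) (g : B -> C) (J : set (set B)).
Hypotheses (fb : is_boolean_hom f) (fK : cancel f g) (gK : cancel g f).
Hypothesis Jtop : is_zd_topology J.
Implicit Types (D P : set C) (x y z : C).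

Lemma bool_iso_le x y : (f x <= f y)%O = (x <= y)%O.
Proof. by rewrite !leEmeet -(bh_meet fb) (can_eq fK). Qed.

Lemma bool_iso_lub D z : isLub (f @` D) (f z) <-> isLub D z.
Proof.
split=> -[ub lub]; split.
- by move=> d Dd; rewrite -bool_iso_le; apply: ub; exists d.
- move=> u uub; rewrite -bool_iso_le; apply: lub => _ [d Dd <-].
  by rewrite bool_iso_le; exact: uub.
- by move=> _ [d Dd <-]; rewrite bool_iso_le; exact: ub.
- move=> u uub; rewrite -(gK u) bool_iso_le; apply: lub => d Dd.
  by rewrite -bool_iso_le gK; apply: uub; exists d.
Qed.

Lemma bool_iso_partition P : is_partition \top%O (f @` P) <-> is_partition \top%O P.
Proof.
split=> -[P0 Plub Pd]; split.
- by move=> P0'; apply: P0; exists \bot%O => //; exact: bh_bot fb.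
- by apply/bool_iso_lub; rewrite (bh_top fb).
- move=> c d Pc Pd' cd; apply: (can_inj fK); rewrite (bh_meet fb) (bh_bot fb).
  by apply: Pd => [||/(can_inj fK)//]; [exists c|exists d].
- by move=> [c Pc]; rewrite -(bh_bot fb) => /(can_inj fK) c0; apply: P0; rewrite -c0.
- by rewrite -(bh_top fb); apply/bool_iso_lub.
- move=> _ _ [c Pc <-] [d Pd' <-] cd; rewrite -(bh_meet fb) Pd ?(bh_bot fb) //.
  by move=> e; apply: cd; rewrite e.
Qed.

Lemma zd_transport : is_zd_topology [set P | J (f @` P)].
Proof.
split=> /=.
- by move=> P /(zd_partition Jtop) /bool_iso_partition.
- move=> P Pf /bool_iso_partition; apply: (zd_finite Jtop); exact: finite_image.
- move=> P Q JP JQ.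
  have JQ' b : (f @` P) b -> J (f @` (Q (g b))).
    by move=> [c Pc <-]; rewrite fK; exact: JQ.
  have := zd_refine Jtop JP JQ'; congr J.
  apply/seteqP; split=> [_ [[_ [c Pc <-] [_ [d Qd <-] <-]] n0]|].
    rewrite fK in Qd; exists (c `&` d)%O; last exact: bh_meet fb _ _.
    split; first by exists c => //; exists d.
    by move=> e; apply: n0; rewrite -(bh_meet fb) e /= (bh_bot fb).
  move=> _ [_ [[c Pc [d Qd <-]] n0] <-].
  split; last by rewrite /= -(bh_bot fb) => /(can_inj fK).
  exists (f c); first by exists c.
  by exists (f d); [exists d; rewrite ?fK|rewrite (bh_meet fb)].
- move=> P I a JP asurj.
  have gP b : b \in f @` P -> g b \in P.
    by rewrite !in_setE => -[c Pc <-]; rewrite fK.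
  pose a' (b : f @` P) : I := a (exist _ (g (val b)) (gP _ (valP b))).
  have fibE i : fibre a' i = f @` fibre a i.
    apply/seteqP; split=> [_ [b bi <-]|_ [_ [c ci <-] <-]].
      exists (g (val b)); last exact: gK.
      by exists (exist _ (g (val b)) (gP _ (valP b))).
    have fc : f (val c) \in f @` P.
      by rewrite in_setE; exists (val c) => //; have := valP c; rewrite in_setE.
    exists (exist _ (f (val c)) fc) => //=; rewrite -ci /a' /=; congr a.
    by apply: val_inj; rewrite /= fK.
  have [|lubE JE] := @zd_coarsen _ _ Jtop _ I a' JP.
    move=> i; have [c ci] := asurj i.
    have fc : f (val c) \in f @` P.
      by rewrite in_setE; exists (val c) => //; have := valP c; rewrite in_setE.
    exists (exist _ (f (val c)) fc); rewrite -ci /a'; congr a.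
    by apply: val_inj; rewrite /= fK.
  split=> [i|].
    have [z zi] := lubE i; exists (g z); apply/bool_iso_lub.
    by rewrite gK -fibE.
  move: JE; congr J; apply/seteqP; split=> [z [i zi]|_ [z [i zi] <-]].
    exists (g z); last exact: gK.
    by exists i; apply/bool_iso_lub; rewrite gK -fibE.
  by exists i; rewrite fibE; apply/bool_iso_lub.
Qed.

End TopologyTransport.

(** * Recovering the matched pair *)

Section PartialCounit.
Variable X : matchedPair.

Local Notation S := (partial_br X).

Let XB : is_Bset (@mp_op X) := mpp_Bset (mp_ax X).

Definition counit_B (e : EBA S) : mpB X := idom e.

Definition counit_M (m : TotT S) : mpM X := tot_ext (tv m).

Definition counit_inv_B (b : mpB X) : EBA S := idem_restr b.

Lemma restr_top_tot (m : mpM X) : (restr \top%O m : S) \in Tot S.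
Proof. by rewrite in_setE. Qed.

Definition counit_inv_M (m : mpM X) : TotT S :=
  exist (fun s => s \in Tot S) (restr \top%O m) (restr_top_tot m).

Lemma tot_ext_restr_top (m : mpM X) : tot_ext (restr \top%O m) = m.
Proof. exact: bs_top XB _ _. Qed.

Lemma tot_restr (m : TotT S) : tv m = restr \top%O (counit_M m).
Proof.
have /restr_eq [m1 _] : restr (dom (tv m)) 1%g = restr \top%O 1%g := totP m.
by rewrite -[LHS]restrK m1.
Qed.

Lemma counit_BK : cancel counit_B counit_inv_B.
Proof. exact: idomK. Qed.

Lemma counit_inv_BK : cancel counit_inv_B counit_B.
Proof. exact: idem_restrK. Qed.

Lemma counit_MK : cancel counit_M counit_inv_M.
Proof. by move=> m; apply: tv_inj; rewrite [RHS]tot_restr. Qed.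

Lemma counit_inv_MK : cancel counit_inv_M counit_M.
Proof. exact: tot_ext_restr_top. Qed.

(** Both sides say that [bm = bn]. The equivalence, and not only the direct
    implication, makes the inverse maps a homomorphism too. *)
Lemma counit_equiv (b : EBA S) (m n : TotT S) :
  bs_equiv (@down_op S) b m n <->
  bs_equiv mp_op (counit_B b) (counit_M m) (counit_M n).
Proof.
rewrite down_equivE -(counit_BK b) !tot_restr.
have -> : (ev (counit_inv_B (counit_B b)) * restr \top%O (counit_M m))%g =
          restr (counit_B b) (counit_M m) :> S by rewrite [LHS]restr1M meetx1.
have -> : (ev (counit_inv_B (counit_B b)) * restr \top%O (counit_M n))%g =
          restr (counit_B b) (counit_M n) :> S by rewrite [LHS]restr1M meetx1.
by rewrite counit_inv_BK; split=> [/restr_eq []//|h]; apply/restr_eq.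
Qed.

Lemma counit_act (m : TotT S) (b : EBA S) :
  mp_act (counit_M m) (counit_B b) = counit_B (down_act m b).
Proof.
rewrite -[in RHS](counit_BK b) -[in RHS](counit_MK m).
by rewrite /down_act [(tv _ * _)%g]restrM meet1x.
Qed.

Lemma counit_mon : monoid_morphism counit_M.
Proof.
split=> [|m n]; first exact: tot_ext_restr_top.
apply: (can_inj counit_inv_MK); rewrite counit_MK; apply: tv_inj.
rewrite -[LHS]/(tv m * tv n)%g (tot_restr m) (tot_restr n) [LHS]restrM meet1x.
by rewrite (bh_top (mpp_hom (mp_ax X) _)).
Qed.

Lemma counit_hom_ax : @is_mp_hom (down_ob S) X counit_B counit_M.
Proof.
split; first exact: idomE.
- exact: counit_mon.
- by move=> b m n /counit_equiv.
- exact: counit_act.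
Qed.

Lemma counit_inv_hom_ax : @is_mp_hom X (down_ob S) counit_inv_B counit_inv_M.
Proof.
have [cb cm _ _] := counit_hom_ax; split.
- by split.
- split=> [|m n]; first exact: tv_inj.
  by apply: (can_inj counit_MK); rewrite cm.2 !counit_inv_MK.
- by move=> b m n h; apply/counit_equiv; rewrite counit_inv_BK !counit_inv_MK.
- move=> m b; apply: (can_inj counit_BK).
  by rewrite -counit_act !counit_inv_BK counit_inv_MK.
Qed.

Definition counit : mp_hom (down_ob S) X := MpHom counit_hom_ax.

Definition counit_inv : mp_hom X (down_ob S) := MpHom counit_inv_hom_ax.

Lemma counitK : mp_comp counit_inv counit = mp_id (down_ob S).
Proof.
by apply: mp_hom_eq; apply/funext; [exact: counit_BK|exact: counit_MK].
Qed.

Lemma counit_invK : mp_comp counit counit_inv = mp_id X.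
Proof.
by apply: mp_hom_eq; apply/funext; [exact: counit_inv_BK|exact: counit_inv_MK].
Qed.

End PartialCounit.

Section GrothendieckCounit.
Variable X : gmatchedPair.

Local Notation S := (partial_br X).
Local Notation J := (@gmp_J X).

Definition partial_J : set (set (EBA S)) := [set P | J (@counit_B X @` P)].

Let Jtop := gmpp_top (gmp_ax X).

Lemma counit_inv_image (P : set (mpB X)) : @counit_B X @` (@counit_inv_B X @` P) = P.
Proof.
by rewrite image_comp; exact: image_id.
Qed.

Lemma partial_admissible (A : set S) :
  admissible partial_J A <-> pairwise_rdisj A /\ subpartition J A.
Proof.
have domE : @dom X @` A = @counit_B X @` (iplus @` A : set (EBA S)).
  by rewrite !image_comp.
split=> -[Ad [P JP AP]]; split=> //.
  exists (@counit_B X @` P); first exact: JP.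
  rewrite domE => _ [[e Ae <-] e0]; exists e => //; apply: AP; split=> //.
  by move=> e0'; apply: e0; rewrite e0'.
exists (@counit_inv_B X @` P); first by rewrite /partial_J /= counit_inv_image.
move=> _ [[a Aa <-] a0]; exists (dom a); last exact: (@counit_BK X (iplus a)).
apply: AP; split; first by exists a.
by move=> e; apply: a0; apply: (can_inj (@counit_BK X)).
Qed.

Lemma partial_gbrMonoid : is_gbrMonoid partial_J.
Proof.
split.
- exact: (zd_transport (idomE X) (@counit_BK X) (@counit_inv_BK X) Jtop).
- move=> A /partial_admissible [Ad Asp].
  by have [j] := subpartition_join_ex (gmp_ax X) Asp Ad; exists j.
- move=> A s /partial_admissible [Ad Asp]; split.
    apply/partial_admissible; split; first exact: pairwise_rdisj_mul.
    exact: (subpartition_mul (gmp_ax X) s Asp).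
  by move=> j; exact: (subpartition_join_mul (gmp_ax X) s Asp Ad).
Qed.

Definition partial_gbr : gbrMonoid := GbrMonoid partial_gbrMonoid.

Lemma counit_topology : preserves_topology partial_J J (@counit_B X).
Proof.
move=> P JP; rewrite not_setD1 //.
by have [+ _ _] := zd_partition Jtop JP.
Qed.

Lemma counit_inv_topology : preserves_topology J partial_J (@counit_inv_B X).
Proof.
move=> P JP; rewrite not_setD1.
  by rewrite /partial_J /= counit_inv_image.
move=> [b Pb b0]; have [P0 _ _] := zd_partition Jtop JP; apply: P0.
by rewrite -[X in P X](congr1 (@counit_B X) b0) counit_inv_BK.
Qed.

Definition gcounit : gmp_hom (gdown_ob partial_gbr) X :=
  @GMpHom (gdown_ob partial_gbr) X (counit X) counit_topology.

Definition gcounit_inv : gmp_hom X (gdown_ob partial_gbr) :=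
  @GMpHom X (gdown_ob partial_gbr) (counit_inv X) counit_inv_topology.

Lemma gcounitK : gmp_comp gcounit_inv gcounit = gmp_id (gdown_ob partial_gbr).
Proof.
have e := counitK X; apply: gmp_hom_eq.
  exact: (congr1 (@mph_B _ _) e).
exact: (congr1 (@mph_M _ _) e).
Qed.

Lemma gcounit_invK : gmp_comp gcounit gcounit_inv = gmp_id X.
Proof.
have e := counit_invK X; apply: gmp_hom_eq.
  exact: (congr1 (@mph_B _ _) e).
exact: (congr1 (@mph_M _ _) e).
Qed.

End GrothendieckCounit.

Theorem theorem3p11 :
  is_equivalence down /\
  is_equivalence gdown /\
  functor_comp gdown incl_br = functor_comp incl_mp down.
Proof.
split; [|split].
- apply: is_equivalence_ff => [S T f g|S T h|X].
  + exact: down_faithful.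
  + by exists (extend_hom h); exact: down_map_extend.
  + exists (partial_br X), (counit X), (counit_inv X).
    by split; [exact: counitK|exact: counit_invK].
- apply: is_equivalence_ff => [S T f g|S T h|X].
  + exact: gdown_faithful.
  + by exists (extend_ghom h); exact: gdown_map_extend.
  + exists (partial_gbr X), (gcounit X), (gcounit_inv X).
    by split; [exact: gcounitK|exact: gcounit_invK].
- exact: gdown_incl_br.
Qed.
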